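(* (a) The index set $UHP=\{e:\mathcal{B}_e\text{ is an ultrahomogeneous tree}\}$ is $\Pi^0_2$ complete relative to $TRP$. (b) The index set $WUP=\{e:\mathcal{B}_e\text{ is a weakly ultrahomogeneous tree}\}$ is $\Sigma^0_3$ complete relative to $TRP$.
   Context: A tree in the predecessor presentation is a structure $(T,f)$ with a root $\epsilon\in T$ and a unary function $f:T\to T$ such that $f(\epsilon)=\epsilon$, every $a\in T$ satisfies $f^n(a)=\epsilon$ for some $n$, and $f^m(a)=f^n(a)$ with $m\ne n$ implies $f^n(a)=\epsilon$. $\{\varphi_e\}_{e\in\omega}$ is the standard enumeration of the partial computable functions. $\mathcal{B}_e=(\omega,\varphi_e,\epsilon)$ is defined when $\varphi_e$ is total and is the predecessor function of a tree with universe $\omega$ and root $\epsilon$; $TRP=\{e:\mathcal{B}_e\text{ is a tree}\}$. A tree (in this presentation) is ultrahomogeneous if every isomorphism between finitely generated substructures (finite subsets closed under $f$) extends to an automorphism; it is weakly ultrahomogeneous if there is a finite set $\{a_1,\dots,a_n\}$ of elements such that every isomorphism between finitely generated substructures containing all $a_i$ and fixing each $a_i$ extends to an automorphism. For a class $\Gamma$ (such as $\Pi^0_2$ or $\Sigma^0_3$) and $B\subseteq C\subseteq\omega$, $B$ is $\Gamma$ complete relative to $C$ if $B=C\cap R$ for some $R\in\Gamma$ and for every $A\in\Gamma$ there is a computable $f$ with $f(i)\in C$ for all $i$ and $i\in A\iff f(i)\in B$ for all $i$. *)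

(* Defs.v *)
From Stdlib Require Import Arith Lia List Cantor.

(** * Partial computable functions *)

Definition cpair (x y : nat) : nat := Cantor.to_nat (x, y).

(** Programs for the unary partial recursive functions; functions of several
    arguments are represented through Cantor pairing. *)
Inductive code : Type :=
| Zero | Succ | Fst | Snd
| Pair (c d : code)
| Comp (c d : code)
| Prec (c d : code)
| Mu (c : code).

(** [eval c x y]: the computation of [c] on input [x] halts with output [y].
    - [Comp c d] is [c] after [d];
    - [Prec c d] sends [cpair a 0] to [c a], and [cpair a (S n)] to
      [d (cpair a (cpair n z))] where [z] is its value at [cpair a n];
    - [Mu c] sends [a] to the least [y] with [c (cpair a y) = 0], all earlier
      values being defined and non-zero. *)
Fixpoint eval (c : code) : nat -> nat -> Prop :=
  match c with
  | Zero => fun _ y => y = 0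
  | Succ => fun x y => y = S x
  | Fst => fun x y => y = fst (Cantor.of_nat x)
  | Snd => fun x y => y = snd (Cantor.of_nat x)
  | Pair c d => fun x y => exists u v, eval c x u /\ eval d x v /\ y = cpair u v
  | Comp c d => fun x y => exists z, eval d x z /\ eval c z y
  | Prec c d => fun x y =>
      let a := fst (Cantor.of_nat x) in
      (fix rec (n : nat) (y : nat) : Prop :=
         match n with
         | 0 => eval c a y
         | S m => exists z, rec m z /\ eval d (cpair a (cpair m z)) y
         end) (snd (Cantor.of_nat x)) y
  | Mu c => fun a y =>
      eval c (cpair a y) 0 /\
      forall m, m < y -> exists k, eval c (cpair a m) (S k)
  end.

Fixpoint encode (c : code) : nat :=
  match c with
  | Zero => 0
  | Succ => 1
  | Fst => 2
  | Snd => 3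
  | Pair c d => 4 + 4 * cpair (encode c) (encode d)
  | Comp c d => 5 + 4 * cpair (encode c) (encode d)
  | Prec c d => 6 + 4 * cpair (encode c) (encode d)
  | Mu c => 7 + 4 * encode c
  end.

(** [phi e x y]: the [e]-th partial computable function is defined at [x] with
    value [y].  By [encode_inj] and [encode_surj] below, every [e] is the
    number of exactly one program. *)
Definition phi (e x y : nat) : Prop := exists c, encode c = e /\ eval c x y.

Definition computes (e : nat) (f : nat -> nat) : Prop :=
  forall x, phi e x (f x).

Definition computable (f : nat -> nat) : Prop := exists e, computes e f.

Lemma cpair_inj a b c d : cpair a b = cpair c d -> a = c /\ b = d.
Proof. unfold cpair; intros H; apply Cantor.to_nat_inj in H; now injection H. Qed.

Lemma encode_inj c d : encode c = encode d -> c = d.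
Proof.
  revert d; induction c; intros d; destruct d; cbn [encode]; intros H;
    try reflexivity; try (exfalso; lia);
    try (lazymatch type of H with
         | _ + 4 * ?p = _ + 4 * ?q => assert (K : p = q) by lia
         end);
    f_equal; try (apply cpair_inj in K; destruct K); auto.
Qed.

Lemma encode_surj e : exists c, encode c = e.
Proof.
  induction e as [e IH] using lt_wf_ind.
  destruct (lt_dec e 4) as [He|He].
  - destruct e as [|[|[|[|e]]]]; [now exists Zero|now exists Succ|
      now exists Fst|now exists Snd|lia].
  - pose proof (Nat.div_mod_eq (e - 4) 4) as Hq.
    pose proof (Nat.mod_upper_bound (e - 4) 4 ltac:(lia)) as Hr.
    set (q := (e - 4) / 4) in *; set (r := (e - 4) mod 4) in *.
    clearbody q r.
    destruct (Cantor.of_nat q) as [a b] eqn:Eq.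
    assert (Hp : cpair a b = q)
      by (unfold cpair; rewrite <- Eq; apply Cantor.cancel_to_of).
    pose proof (Cantor.to_nat_non_decreasing a b) as Hle.
    change (b + a <= cpair a b) in Hle.
    destruct (IH a ltac:(lia)) as [c Hc].
    destruct (IH b ltac:(lia)) as [d Hd].
    destruct (IH q ltac:(lia)) as [c' Hc'].
    destruct r as [|[|[|[|r]]]]; [| | | |lia].
    + exists (Pair c d); cbn [encode]; rewrite Hc, Hd; lia.
    + exists (Comp c d); cbn [encode]; rewrite Hc, Hd; lia.
    + exists (Prec c d); cbn [encode]; rewrite Hc, Hd; lia.
    + exists (Mu c'); cbn [encode]; lia.
Qed.

Lemma eval_functional c x y y' : eval c x y -> eval c x y' -> y = y'.
Proof.
  revert x y y'; induction c as [| | | |c IHc d IHd|c IHc d IHd|c IHc d IHd|c IHc];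
    cbn [eval]; intros x y y'; try congruence.
  - intros (u & v & Hu & Hv & ->) (u' & v' & Hu' & Hv' & ->).
    now rewrite (IHc _ _ _ Hu Hu'), (IHd _ _ _ Hv Hv').
  - intros (z & Hz & Hy) (z' & Hz' & Hy').
    rewrite (IHd _ _ _ Hz Hz') in Hy; eauto.
  - cbv zeta; generalize (fst (Cantor.of_nat x)) as a.
    generalize (snd (Cantor.of_nat x)) as n; intros n a; revert y y'.
    induction n as [|n IHn]; intros y y'; [apply IHc|].
    intros (z & Hz & Hy) (z' & Hz' & Hy').
    rewrite (IHn _ _ Hz Hz') in Hy; eauto.
  - intros [H0 Hlt] [H0' Hlt'].
    destruct (lt_eq_lt_dec y y') as [[H|H]|H]; auto; exfalso.
    + destruct (Hlt' _ H) as [k Hk]; discriminate (IHc _ _ _ H0 Hk).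
    + destruct (Hlt _ H) as [k Hk]; discriminate (IHc _ _ _ H0' Hk).
Qed.

(** * The arithmetical hierarchy and relative completeness *)

Definition computable_set (A : nat -> Prop) : Prop :=
  exists chi, computable chi /\
    forall x, (A x /\ chi x = 1) \/ (~ A x /\ chi x = 0).

Fixpoint Sigma0 (n : nat) (A : nat -> Prop) : Prop :=
  match n with
  | 0 => computable_set A
  | S m => exists R, Pi0 m R /\ forall x, A x <-> exists y, R (cpair x y)
  end
with Pi0 (n : nat) (A : nat -> Prop) : Prop :=
  match n with
  | 0 => computable_set A
  | S m => exists R, Sigma0 m R /\ forall x, A x <-> forall y, R (cpair x y)
  end.

Definition complete_relative
    (Gamma : (nat -> Prop) -> Prop) (B C : nat -> Prop) : Prop :=
  (forall x, B x -> C x) /\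
  (exists R, Gamma R /\ forall x, B x <-> C x /\ R x) /\
  (forall A, Gamma A ->
     exists f, computable f /\ (forall i, C (f i)) /\
               forall i, A i <-> B (f i)).

(** * Trees in the predecessor presentation *)

Section Trees.

Context {T : Type} (f : T -> T) (eps : T).

Definition is_tree : Prop :=
  f eps = eps /\
  (forall a, exists n, Nat.iter n f a = eps) /\
  (forall a m n, m <> n -> Nat.iter m f a = Nat.iter n f a ->
                 Nat.iter n f a = eps).

(** The root is a constant of the structure, so it lies in every
    substructure. *)
Definition fg_substructure (S : T -> Prop) : Prop :=
  S eps /\ (forall x, S x -> S (f x)) /\
  exists l : list T, forall x, S x <-> In x l.

(** Only the values of [h] on [S] matter. *)
Definition isomorphism (S S' : T -> Prop) (h : T -> T) : Prop :=
  (forall x, S x -> S' (h x)) /\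
  (forall x y, S x -> S y -> h x = h y -> x = y) /\
  (forall y, S' y -> exists x, S x /\ h x = y) /\
  (forall x, S x -> h (f x) = f (h x)) /\
  h eps = eps.

Definition automorphism (g : T -> T) : Prop :=
  isomorphism (fun _ => True) (fun _ => True) g.

Definition extends_to_automorphism (S : T -> Prop) (h : T -> T) : Prop :=
  exists g, automorphism g /\ forall x, S x -> g x = h x.

Definition ultrahomogeneous : Prop :=
  forall S S' h,
    fg_substructure S -> fg_substructure S' -> isomorphism S S' h ->
    extends_to_automorphism S h.

Definition weakly_ultrahomogeneous : Prop :=
  exists l : list T,
    forall S S' h,
      fg_substructure S -> fg_substructure S' ->
      (forall a, In a l -> S a /\ S' a /\ h a = a) ->
      isomorphism S S' h ->
      extends_to_automorphism S h.

End Trees.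

(** * Index sets

    [eps] is the natural number serving as the root of the structures
    [B_e = (nat, phi_e, eps)]. *)

Definition B_is (eps : nat) (P : (nat -> nat) -> nat -> Prop) (e : nat) : Prop :=
  exists f, computes e f /\ is_tree f eps /\ P f eps.

Definition TRP (eps : nat) : nat -> Prop := B_is eps (fun _ _ => True).
Definition UHP (eps : nat) : nat -> Prop := B_is eps ultrahomogeneous.
Definition WUP (eps : nat) : nat -> Prop := B_is eps weakly_ultrahomogeneous.

(* Main.v *)
Require Import Defs.
From Stdlib Require Import Arith Lia List Cantor.
From Stdlib Require Import Classical ClassicalEpsilon IndefiniteDescription
  FunctionalExtensionality.
Import ListNotations.

(** Fix a set [C] of nodes of a tree, and call two nodes similar over [C] if they
    have the same first ancestor in [C], at the same distance. If [C] is a finite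
    substructure, similar nodes are exactly those that some isomorphism over [C]
    between finitely generated substructures can match. Hence, if all such
    isomorphisms extend to automorphisms, similar nodes have equally many
    children; conversely, if they do, a back-and-forth construction extends every
    such isomorphism, since a new child of a node always finds an unused child of
    the image of that node ([balanced_of_homogeneous],
    [homogeneous_of_balanced]). Enlarging [C] only refines similarity, so initial
    segments of the natural numbers suffice as sets of parameters:
    a tree on the natural numbers is ultrahomogeneous iff it is balanced over
    its root, and weakly ultrahomogeneous iff for some [m] it is balanced over
    the root and the numbers below [m] ([ultrahomogeneous_iff],
    [weakly_ultrahomogeneous_iff]).

    Upper bounds. Similarity of two nodes and having at least [n] children are
    witnessed by finite sequences of values of the predecessor function, so they
    are semidecidable uniformly in a program for it; this rests on the
    semidecidability of the universal relation [phi], a halting computation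
    being certified by the finite set of its calls ([phi_iff],
    [semidec_phi]). Being balanced is then an implication between semidecidable
    conditions under universal quantifiers, which is [Pi0 2], and the quantifier
    over [m] makes it [Sigma0 3].

    Lower bounds. All reductions produce combs: trees of height two in which
    branch [x] has infinitely many children if [x = 0], and otherwise one child
    for each [s] with [Q x s], where [Q] is decidable ([comb_reduction]). For a
    predicate of the form [forall x, exists y, R x y], let branch [S x] have
    infinitely many children if [x] has a witness, and none otherwise; the
    comb is ultrahomogeneous iff all branches have infinitely many children. For
    [exists w, forall x, exists y, R w x y], let [milestone] turn the inner
    [Pi0 2] condition on [w] into the infinity of a decidable set, and give branch
    [x] at least [x] children, and infinitely many iff some [w <= x] satisfies
    the condition. If some [w] does, almost all branches have infinitely many
    children, and fixing the others makes the comb balanced; if none does, the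
    numbers of children are finite and unbounded, and no finite set of parameters
    can separate all branches that differ. *)

(** * Closure properties of the computable functions *)

Definition pi1 (p : nat) : nat := fst (Cantor.of_nat p).
Definition pi2 (p : nat) : nat := snd (Cantor.of_nat p).

#[local] Arguments cpair : simpl never.
#[local] Arguments pi1 : simpl never.
#[local] Arguments pi2 : simpl never.

Lemma pi1_cpair a b : pi1 (cpair a b) = a.
Proof. unfold pi1, cpair; now rewrite Cantor.cancel_of_to. Qed.

Lemma pi2_cpair a b : pi2 (cpair a b) = b.
Proof. unfold pi2, cpair; now rewrite Cantor.cancel_of_to. Qed.

Lemma cpair_pi p : cpair (pi1 p) (pi2 p) = p.
Proof.
  unfold pi1, pi2, cpair; rewrite <- surjective_pairing; apply Cantor.cancel_to_of.
Qed.

Lemma computable_iff f : computable f <-> exists c, forall x, eval c x (f x).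
Proof.
  split.
  - intros [e He]; destruct (encode_surj e) as [c Hc]; exists c; intros x.
    destruct (He x) as (c' & Hc' & Hx).
    now rewrite (encode_inj c c') by congruence.
  - intros [c Hc]; exists (encode c); intros x; now exists c.
Qed.

Lemma computable_ext f g : (forall x, f x = g x) -> computable f -> computable g.
Proof. intros H [e He]; exists e; intros x; rewrite <- H; apply He. Qed.

Lemma computable_comp g f :
  computable g -> computable f -> computable (fun p => g (f p)).
Proof.
  rewrite !computable_iff; intros [c Hc] [d Hd]; exists (Comp c d); intros x.
  exists (f x); auto.
Qed.

Lemma computable_id : computable (fun p => p).
Proof.
  apply computable_iff; exists (Pair Fst Snd); intros x.
  exists (pi1 x), (pi2 x); repeat split; symmetry; apply cpair_pi.
Qed.

Lemma computable_S f : computable f -> computable (fun p => S (f p)).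
Proof.
  apply (computable_comp S), computable_iff; now exists Succ.
Qed.

Lemma computable_const n : computable (fun _ => n).
Proof.
  induction n as [|n IH].
  - apply computable_iff; now exists Zero.
  - now apply (computable_S (fun _ => n)).
Qed.

Lemma computable_pi1 f : computable f -> computable (fun p => pi1 (f p)).
Proof. apply (computable_comp pi1), computable_iff; now exists Fst. Qed.

Lemma computable_pi2 f : computable f -> computable (fun p => pi2 (f p)).
Proof. apply (computable_comp pi2), computable_iff; now exists Snd. Qed.

Lemma computable_cpair f g :
  computable f -> computable g -> computable (fun p => cpair (f p) (g p)).
Proof.
  rewrite !computable_iff; intros [c Hc] [d Hd]; exists (Pair c d); intros x.
  exists (f x), (g x); auto.
Qed.

(** Recursion that keeps the whole input [p] as its parameter. *)
Lemma computable_rec b s n :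
  computable b ->
  computable (fun q => s (pi1 q) (pi1 (pi2 q)) (pi2 (pi2 q))) ->
  computable n ->
  computable (fun p => nat_rec (fun _ => nat) (b p) (s p) (n p)).
Proof.
  intros Hb Hs Hn.
  assert (H : computable (fun q =>
            nat_rec (fun _ => nat) (b (pi1 q)) (s (pi1 q)) (pi2 q))).
  { apply computable_iff in Hb as [c Hc]; apply computable_iff in Hs as [d Hd].
    apply computable_iff; exists (Prec c d); intros q; cbn [eval]; cbv zeta.
    fold (pi1 q) (pi2 q); induction (pi2 q) as [|m IH]; [apply Hc|].
    eexists; split; [exact IH|].
    specialize (Hd (cpair (pi1 q) (cpair m
      (nat_rec (fun _ => nat) (b (pi1 q)) (s (pi1 q)) m)))).
    now rewrite !pi2_cpair, !pi1_cpair in Hd. }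
  apply (computable_comp _ (fun p => cpair p (n p))) in H.
  - revert H; apply computable_ext; intros p; now rewrite pi1_cpair, pi2_cpair.
  - now apply computable_cpair; [apply computable_id|].
Qed.

Create HintDb comp discriminated.
#[local] Hint Constants Opaque : comp.
#[local] Hint Resolve computable_const computable_id computable_S computable_pi1
  computable_pi2 computable_cpair : comp.

Ltac comp := auto 100 with comp.

Definition cond (n u v : nat) : nat := match n with 0 => v | S _ => u end.

Lemma computable_cond n u v :
  computable n -> computable u -> computable v ->
  computable (fun p => cond (n p) (u p) (v p)).
Proof.
  intros Hn Hu Hv.
  apply computable_ext with
    (f := fun p => nat_rec (fun _ => nat) (v p) (fun _ _ => u p) (n p)).
  - intros p; now destruct (n p).
  - apply (computable_rec v (fun p _ _ => u p)); trivial.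
    apply (computable_comp u); comp.
Qed.

Lemma computable_add f g :
  computable f -> computable g -> computable (fun p => f p + g p).
Proof.
  intros Hf Hg.
  apply computable_ext with
    (f := fun p => nat_rec (fun _ => nat) (f p) (fun _ z => S z) (g p)).
  - intros p; induction (g p) as [|m IH]; cbn; lia.
  - apply (computable_rec f (fun _ _ z => S z)); comp.
Qed.

#[local] Hint Resolve computable_cond computable_add : comp.

Lemma computable_mul f g :
  computable f -> computable g -> computable (fun p => f p * g p).
Proof.
  intros Hf Hg.
  apply computable_ext with
    (f := fun p => nat_rec (fun _ => nat) 0 (fun _ z => z + f p) (g p)).
  - intros p; induction (g p) as [|m IH]; cbn; lia.
  - apply (computable_rec (fun _ => 0) (fun p _ z => z + f p)); comp.
    apply computable_add; comp; apply (computable_comp f); comp.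
Qed.

Lemma computable_pred f : computable f -> computable (fun p => pred (f p)).
Proof.
  intros Hf.
  apply computable_ext with
    (f := fun p => nat_rec (fun _ => nat) 0 (fun m _ => m) (f p)).
  - intros p; now destruct (f p).
  - apply (computable_rec (fun _ => 0) (fun _ m _ => m)); comp.
Qed.

#[local] Hint Resolve computable_mul computable_pred : comp.

Lemma computable_sub f g :
  computable f -> computable g -> computable (fun p => f p - g p).
Proof.
  intros Hf Hg.
  apply computable_ext with
    (f := fun p => nat_rec (fun _ => nat) (f p) (fun _ z => pred z) (g p)).
  - intros p; induction (g p) as [|m IH]; cbn; [lia|].
    change (nat_rec _ _ _ _) with
      (nat_rec (fun _ => nat) (f p) (fun _ z => pred z) m) in *; lia.
  - apply (computable_rec f (fun _ _ z => pred z)); comp.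
Qed.

#[local] Hint Resolve computable_sub : comp.

(** * Decidable predicates *)

Lemma computable_set_ext A B :
  (forall x, A x <-> B x) -> computable_set A -> computable_set B.
Proof.
  intros H (chi & Hc & Hx); exists chi; split; trivial.
  intros x; rewrite <- H; apply Hx.
Qed.

Lemma computable_set_comp A f :
  computable_set A -> computable f -> computable_set (fun p => A (f p)).
Proof.
  intros (chi & Hc & Hx) Hf; exists (fun p => chi (f p)); split; auto.
  now apply computable_comp.
Qed.

Lemma computable_set_not A : computable_set A -> computable_set (fun p => ~ A p).
Proof.
  intros (chi & Hc & Hx); exists (fun p => cond (chi p) 0 1); split; comp.
  intros p; destruct (Hx p) as [[H ->]|[H ->]]; cbn; tauto.
Qed.

Lemma computable_set_and A B :
  computable_set A -> computable_set B -> computable_set (fun p => A p /\ B p).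
Proof.
  intros (chi & Hc & Hx) (chi' & Hc' & Hx').
  exists (fun p => cond (chi p) (chi' p) 0); split; comp.
  intros p; destruct (Hx p) as [[H ->]|[H ->]], (Hx' p) as [[H' ->]|[H' ->]];
    cbn; tauto.
Qed.

Lemma computable_set_or A B :
  computable_set A -> computable_set B -> computable_set (fun p => A p \/ B p).
Proof.
  intros (chi & Hc & Hx) (chi' & Hc' & Hx').
  exists (fun p => cond (chi p) 1 (chi' p)); split; comp.
  intros p; destruct (Hx p) as [[H ->]|[H ->]], (Hx' p) as [[H' ->]|[H' ->]];
    cbn; tauto.
Qed.

Lemma computable_set_le f g :
  computable f -> computable g -> computable_set (fun p => f p <= g p).
Proof.
  intros Hf Hg; exists (fun p => cond (f p - g p) 0 1); split; comp.
  intros p; destruct (f p - g p) eqn:E; cbn; lia.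
Qed.

#[local] Hint Resolve computable_set_not computable_set_and computable_set_or
  computable_set_le : comp.

Lemma computable_set_lt f g :
  computable f -> computable g -> computable_set (fun p => f p < g p).
Proof. intros; apply (computable_set_le (fun p => S (f p))); comp. Qed.

Lemma computable_set_eq f g :
  computable f -> computable g -> computable_set (fun p => f p = g p).
Proof.
  intros; apply computable_set_ext with (fun p => f p <= g p /\ g p <= f p); comp.
  intros; lia.
Qed.

#[local] Hint Resolve computable_set_lt computable_set_eq : comp.

Lemma computable_set_bex b Q :
  computable b -> computable_set (fun q => Q (pi1 q) (pi2 q)) ->
  computable_set (fun p => exists i, i < b p /\ Q p i).
Proof.
  intros Hb (chi & Hc & Hx).
  exists (fun p => nat_rec (fun _ => nat) 0
                     (fun m z => cond (chi (cpair p m)) 1 z) (b p)); split.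
  - apply (computable_rec (fun _ => 0) (fun p m z => cond (chi (cpair p m)) 1 z));
      comp.
    apply computable_cond; comp; apply (computable_comp chi); comp.
  - intros p; induction (b p) as [|m IH]; cbn.
    + right; split; trivial; intros (i & Hi & _); lia.
    + specialize (Hx (cpair p m)); rewrite pi1_cpair, pi2_cpair in Hx.
      destruct Hx as [[H ->]|[H ->]]; cbn.
      * left; split; trivial; exists m; auto.
      * destruct IH as [[(i & Hi & Hq) E]|[Hn E]]; [left|right]; split; trivial.
        -- exists i; auto.
        -- intros (i & Hi & Hq); destruct (Nat.eq_dec i m) as [->|Hne]; auto.
           apply Hn; exists i; split; trivial; lia.
Qed.

#[local] Hint Resolve computable_set_bex : comp.

Lemma computable_set_ball b Q :
  computable b -> computable_set (fun q => Q (pi1 q) (pi2 q)) ->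
  computable_set (fun p => forall i, i < b p -> Q p i).
Proof.
  intros Hb HQ.
  apply computable_set_ext with (fun p => ~ exists i, i < b p /\ ~ Q p i).
  - intros p; split; [|firstorder].
    intros H i Hi; apply NNPP; intros Hn; apply H; eauto.
  - apply computable_set_not, (computable_set_bex b (fun p i => ~ Q p i)); comp.
Qed.

#[local] Hint Resolve computable_set_ball : comp.

(** * Semidecidable predicates *)

Notation semidec := (Sigma0 1).

Lemma semidec_ext A B : (forall x, A x <-> B x) -> semidec A -> semidec B.
Proof.
  intros H (R & HR & Hx); exists R; split; trivial.
  intros x; rewrite <- H; apply Hx.
Qed.

Lemma semidec_comp A f :
  semidec A -> computable f -> semidec (fun p => A (f p)).
Proof.
  intros (R & HR & Hx) Hf; exists (fun q => R (cpair (f (pi1 q)) (pi2 q))); split.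
  - apply computable_set_comp; trivial; apply computable_cpair; comp.
    apply (computable_comp f); comp.
  - intros x; rewrite Hx; split; intros [y Hy]; exists y; revert Hy;
      now rewrite pi1_cpair, pi2_cpair.
Qed.

Lemma semidec_computable_set A : computable_set A -> semidec A.
Proof.
  intros HA; exists (fun q => A (pi1 q)); split.
  - apply computable_set_comp; comp.
  - intros x; split; [exists 0|intros [y Hy]; revert Hy]; now rewrite pi1_cpair.
Qed.

Lemma semidec_ex Q :
  semidec (fun q => Q (pi1 q) (pi2 q)) -> semidec (fun p => exists i, Q p i).
Proof.
  intros (R & HR & Hx).
  exists (fun q => R (cpair (cpair (pi1 q) (pi1 (pi2 q))) (pi2 (pi2 q)))); split.
  - apply computable_set_comp; comp.
  - intros p; split.
    + intros [i Hi]; specialize (Hx (cpair p i)); rewrite pi1_cpair, pi2_cpair in Hx.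
      apply Hx in Hi as [y Hy]; exists (cpair i y).
      now repeat rewrite ?pi1_cpair, ?pi2_cpair.
    + intros [y Hy]; rewrite pi1_cpair, pi2_cpair in Hy.
      exists (pi1 y); specialize (Hx (cpair p (pi1 y))).
      rewrite pi1_cpair, pi2_cpair in Hx; apply Hx; eauto.
Qed.

Lemma semidec_and A B : semidec A -> semidec B -> semidec (fun p => A p /\ B p).
Proof.
  intros (R & HR & Hx) (R' & HR' & Hx').
  apply semidec_ext with
    (fun p => exists y, R (cpair p (pi1 y)) /\ R' (cpair p (pi2 y))).
  - intros p; rewrite Hx, Hx'; split.
    + intros (y & H & H'); eauto.
    + intros [[y H] [y' H']]; exists (cpair y y'); now rewrite pi1_cpair, pi2_cpair.
  - apply (semidec_ex (fun p y => R (cpair p (pi1 y)) /\ R' (cpair p (pi2 y)))).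
    apply semidec_computable_set, computable_set_and;
      apply computable_set_comp; comp.
Qed.

Lemma semidec_or A B : semidec A -> semidec B -> semidec (fun p => A p \/ B p).
Proof.
  intros (R & HR & Hx) (R' & HR' & Hx').
  exists (fun q => R q \/ R' q); split; [now apply computable_set_or|].
  intros p; rewrite Hx, Hx'; firstorder.
Qed.

(** Finitely many witnesses have a common bound, so a bounded universal
    quantifier moves past an existential one at the price of bounding the latter. *)
Lemma semidec_ball b Q :
  computable b -> semidec (fun q => Q (pi1 q) (pi2 q)) ->
  semidec (fun p => forall i, i < b p -> Q p i).
Proof.
  intros Hb (R & HR & Hx).
  apply semidec_ext with
    (fun p => exists B, forall i, i < b p ->
                exists y, y < B /\ R (cpair (cpair p i) y)).
  - assert (Hx' : forall p i, Q p i <-> exists y, R (cpair (cpair p i) y)).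
    { intros p i; specialize (Hx (cpair p i)).
      now rewrite pi1_cpair, pi2_cpair in Hx. }
    intros p; split.
    + intros [B HB] i Hi; apply Hx'; firstorder.
    + induction (b p) as [|n IH]; intros H; [exists 0; lia|].
      destruct IH as [B HB]; [auto|].
      destruct (proj1 (Hx' p n)) as [y Hy]; [auto|].
      exists (B + S y); intros i Hi.
      destruct (Nat.eq_dec i n) as [->|Hne]; [exists y; split; trivial; lia|].
      destruct (HB i ltac:(lia)) as (z & Hz & Hr); exists z; split; trivial; lia.
  - apply (semidec_ex (fun p B => forall i, i < b p ->
             exists y, y < B /\ R (cpair (cpair p i) y))).
    apply semidec_computable_set.
    apply (computable_set_ball (fun q => b (pi1 q)) (fun q i =>
             exists y, y < pi2 q /\ R (cpair (cpair (pi1 q) i) y))).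
    + apply (computable_comp b); comp.
    + apply (computable_set_bex (fun q => pi2 (pi1 q))
               (fun q y => R (cpair (cpair (pi1 (pi1 q)) (pi2 q)) y))); comp.
      apply computable_set_comp; comp.
Qed.

#[local] Hint Resolve semidec_ex semidec_and semidec_or semidec_ball : comp.
(* Splitting connectives first avoids vain attempts to decide a formula whose
   atoms are only semidecidable. *)
#[local] Hint Resolve semidec_computable_set | 10 : comp.

(** * Finite sequences as numbers *)

Definition entry (w i : nat) : nat := pi1 (Nat.iter i pi2 w).

Lemma computable_entry w i :
  computable w -> computable i -> computable (fun p => entry (w p) (i p)).
Proof.
  intros Hw Hi; apply computable_pi1.
  apply computable_ext with
    (f := fun p => nat_rec (fun _ => nat) (w p) (fun _ z => pi2 z) (i p)).
  - intros p; induction (i p) as [|m IH]; cbn; [trivial|f_equal; apply IH].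
  - apply (computable_rec w (fun _ _ z => pi2 z)); comp.
Qed.

#[local] Hint Resolve computable_entry : comp.

Lemma entry_surj (g : nat -> nat) n : exists w, forall i, i < n -> entry w i = g i.
Proof.
  revert g; induction n as [|n IH]; intros g; [exists 0; lia|].
  destruct (IH (fun i => g (S i))) as [w Hw].
  exists (cpair (g 0) w); intros [|i] Hi; [apply pi1_cpair|].
  rewrite <- Hw by lia; unfold entry.
  now rewrite Nat.iter_succ_r, pi2_cpair.
Qed.

(** * The graph of the universal function is semidecidable *)

(** One step of the recursive definition of [phi], relative to a set [F] of
    triples (program, input, output) for the calls that the step relies on. *)
Definition justified (F : nat -> nat -> nat -> Prop) (e x y : nat) : Prop :=
  (e = 0 /\ y = 0) \/ (e = 1 /\ y = S x) \/
  (e = 2 /\ y = pi1 x) \/ (e = 3 /\ y = pi2 x) \/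
  (exists c d, e = 4 + 4 * cpair c d /\
     exists u v, F c x u /\ F d x v /\ y = cpair u v) \/
  (exists c d, e = 5 + 4 * cpair c d /\ exists z, F d x z /\ F c z y) \/
  (exists c d, e = 6 + 4 * cpair c d /\ pi2 x = 0 /\ F c (pi1 x) y) \/
  (exists c d, e = 6 + 4 * cpair c d /\
     exists m z, pi2 x = S m /\ F e (cpair (pi1 x) m) z /\
                 F d (cpair (pi1 x) (cpair m z)) y) \/
  (exists c, e = 7 + 4 * c /\ F c (cpair x y) 0 /\
     forall m, m < y -> exists k, F c (cpair x m) (S k)).

Lemma justified_mono (F G : nat -> nat -> nat -> Prop) e x y :
  (forall e x y, F e x y -> G e x y) -> justified F e x y -> justified G e x y.
Proof.
  intros H.
  intros [J|[J|[J|[J|[(c & d & J)|[(c & d & J)|[(c & d & J)|[(c & d & J)|(c & J)]]]]]]]].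
  - now left.
  - right; now left.
  - do 2 right; now left.
  - do 3 right; now left.
  - do 4 right; left; exists c, d; firstorder.
  - do 5 right; left; exists c, d; firstorder.
  - do 6 right; left; exists c, d; firstorder.
  - do 7 right; left; exists c, d; destruct J as (J & m & z & J1 & J2 & J3).
    split; trivial; exists m, z; auto.
  - do 8 right; exists c; destruct J as (J & J0 & J1); repeat split; auto.
    intros m Hm; destruct (J1 m Hm); eauto.
Qed.

Ltac step_cases HF Hx :=
  apply HF in Hx; unfold justified in Hx; cbn [encode] in Hx;
  repeat destruct Hx as [Hx|Hx];
  lazymatch type of Hx with
  | exists c d, _ /\ _ => destruct Hx as (c' & d' & E & Hx)
  | exists c, _ /\ _ => destruct Hx as (c' & E & Hx)
  | _ /\ _ => destruct Hx as [E Hx]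
  end;
  try (exfalso; lia).

(** Every call made by a step is to a smaller program, or to the same program
    with a smaller recursion argument; hence facts that justify one another
    cannot be circular, and no order on them has to be recorded. *)
Lemma justified_phi (F : nat -> nat -> nat -> Prop) :
  (forall e x y, F e x y -> justified F e x y) ->
  forall e x y, F e x y -> phi e x y.
Proof.
  intros HF e; destruct (encode_surj e) as [c <-].
  enough (H : forall x y, F (encode c) x y -> eval c x y) by (exists c; auto).
  induction c as [| | | |c IHc d IHd|c IHc d IHd|c IHc d IHd|c IHc]; intros x y Hx.
  1-4: step_cases HF Hx; exact Hx.
  - step_cases HF Hx; destruct (cpair_inj (encode c) (encode d) c' d' ltac:(lia)) as [<- <-].
    destruct Hx as (u & v & Hu & Hv & ->); exists u, v; auto.
  - step_cases HF Hx; destruct (cpair_inj (encode c) (encode d) c' d' ltac:(lia)) as [<- <-].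
    destruct Hx as (z & Hz & Hy); exists z; auto.
  - cbn [eval]; cbv zeta; fold (pi1 x) (pi2 x).
    rewrite <- (cpair_pi x) in Hx; revert Hx; generalize (pi1 x) as a.
    generalize (pi2 x) as n; intros n a; revert y.
    induction n as [|n IHn]; intros y Hx; step_cases HF Hx;
      destruct (cpair_inj (encode c) (encode d) c' d' ltac:(lia)) as [<- <-];
      rewrite ?pi1_cpair, ?pi2_cpair in Hx.
    + apply IHc, Hx.
    + destruct Hx as (m & z & E' & _); discriminate E'.
    + destruct Hx as [E' _]; discriminate E'.
    + destruct Hx as (m & z & E' & Hz & Hy); injection E' as <-.
      exists z; split; [exact (IHn _ Hz)|exact (IHd _ _ Hy)].
  - step_cases HF Hx; assert (encode c = c') as <- by lia.
    destruct Hx as [H0 Hlt]; split; auto.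
    intros m Hm; destruct (Hlt m Hm) as [k Hk]; eauto.
Qed.

Definition holds_in (L : list (nat * nat * nat)) (e x y : nat) : Prop :=
  In (e, x, y) L.

Definition certificate (L : list (nat * nat * nat)) : Prop :=
  forall e x y, holds_in L e x y -> justified (holds_in L) e x y.

Lemma certificate_app L L' :
  certificate L -> certificate L' -> certificate (L ++ L').
Proof.
  intros H H' e x y Hx; apply in_app_or in Hx as [Hx|Hx]; [apply H in Hx|apply H' in Hx];
    revert Hx; apply justified_mono; intros ? ? ? ?; apply in_or_app; auto.
Qed.

Lemma certificate_cons L e x y :
  certificate L -> justified (holds_in L) e x y -> certificate ((e, x, y) :: L).
Proof.
  intros HL J e' x' y' [E|Hx].
  - injection E as <- <- <-; revert J; apply justified_mono; now right.
  - apply HL in Hx; revert Hx; apply justified_mono; now right.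
Qed.

(** A halting computation makes finitely many calls. *)
Lemma eval_certificate c x y :
  eval c x y -> exists L, certificate L /\ holds_in L (encode c) x y.
Proof.
  assert (Step : forall e x y L, certificate L -> justified (holds_in L) e x y ->
            exists L, certificate L /\ holds_in L e x y).
  { intros e a b L HL J; exists ((e, a, b) :: L); split; [|now left].
    now apply certificate_cons. }
  revert x y; induction c as [| | | |c IHc d IHd|c IHc d IHd|c IHc d IHd|c IHc];
    intros x y Hx.
  - apply (Step 0 x y []); [now intros ? ? ? []|]; now left.
  - apply (Step 1 x y []); [now intros ? ? ? []|]; right; now left.
  - apply (Step 2 x y []); [now intros ? ? ? []|]; do 2 right; now left.
  - apply (Step 3 x y []); [now intros ? ? ? []|]; do 3 right; now left.
  - destruct Hx as (u & v & Hu & Hv & ->).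
    destruct (IHc _ _ Hu) as (L & HL & Hc), (IHd _ _ Hv) as (L' & HL' & Hd).
    apply (Step _ _ _ (L ++ L')); [now apply certificate_app|].
    do 4 right; left; exists (encode c), (encode d); split; trivial.
    exists u, v; repeat split; apply in_or_app; auto.
  - destruct Hx as (z & Hz & Hy).
    destruct (IHd _ _ Hz) as (L & HL & Hd), (IHc _ _ Hy) as (L' & HL' & Hc).
    apply (Step _ _ _ (L ++ L')); [now apply certificate_app|].
    do 5 right; left; exists (encode c), (encode d); split; trivial.
    exists z; split; apply in_or_app; auto.
  - cbn [eval] in Hx; cbv zeta in Hx; fold (pi1 x) (pi2 x) in Hx.
    rewrite <- (cpair_pi x); revert Hx; generalize (pi1 x) as a.
    generalize (pi2 x) as n; intros n a; revert y.
    induction n as [|n IHn]; intros y Hx.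
    + destruct (IHc _ _ Hx) as (L & HL & Hc).
      apply (Step _ _ _ L); trivial.
      do 6 right; left; exists (encode c), (encode d).
      now rewrite pi1_cpair, pi2_cpair.
    + destruct Hx as (z & Hz & Hy).
      destruct (IHn _ Hz) as (L & HL & Hn), (IHd _ _ Hy) as (L' & HL' & Hd).
      apply (Step _ _ _ (L ++ L')); [now apply certificate_app|].
      do 7 right; left; exists (encode c), (encode d); split; trivial.
      exists n, z; rewrite pi1_cpair, pi2_cpair.
      repeat split; apply in_or_app; auto.
  - destruct Hx as [H0 Hlt].
    assert (HL : exists L, certificate L /\ forall m, m < y ->
                   exists k, holds_in L (encode c) (cpair x m) (S k)).
    { clear H0; induction y as [|y IHy].
      - exists []; split; [now intros ? ? ? []|lia].
      - destruct IHy as (L & HL & Hm); [auto|].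
        destruct (Hlt y) as [k Hk]; [auto|].
        destruct (IHc _ _ Hk) as (L' & HL' & Hc).
        exists (L ++ L'); split; [now apply certificate_app|].
        intros m Hlt'; destruct (Nat.eq_dec m y) as [->|Hne].
        + exists k; apply in_or_app; auto.
        + destruct (Hm m ltac:(lia)) as [k' Hk'].
          exists k'; apply in_or_app; auto. }
    destruct HL as (L & HL & Hm), (IHc _ _ H0) as (L' & HL' & Hc).
    apply (Step _ _ _ (L ++ L')); [now apply certificate_app|].
    do 8 right; exists (encode c); repeat split; [apply in_or_app; auto|].
    intros m Hlt'; destruct (Hm m Hlt') as [k Hk]; exists k; apply in_or_app; auto.
Qed.

Definition triple (e x y : nat) : nat := cpair e (cpair x y).

(** A finite set of triples as one number: a length, paired with a sequence of
    which only the entries before that length count. *)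
Definition listed (w e x y : nat) : Prop :=
  exists i, i < pi1 w /\ entry (pi2 w) i = triple e x y.

Lemma listed_list L : exists w, forall e x y, listed w e x y <-> holds_in L e x y.
Proof.
  set (g := fun t : nat * nat * nat => triple (fst (fst t)) (snd (fst t)) (snd t)).
  destruct (entry_surj (fun i => nth i (map g L) 0) (length L)) as [w Hw].
  exists (cpair (length L) w); intros e x y; unfold listed, holds_in.
  rewrite pi1_cpair, pi2_cpair; split.
  - intros (i & Hi & E); rewrite Hw in E by trivial.
    rewrite nth_indep with (d' := g (0, 0, 0)) in E by now rewrite length_map.
    rewrite map_nth in E.
    apply cpair_inj in E as [E1 E]; apply cpair_inj in E as [E2 E3].
    rewrite <- E1, <- E2, <- E3, <- !surjective_pairing; now apply nth_In.
  - intros Hin; apply (in_map g), (In_nth _ _ 0) in Hin as (i & Hi & E).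
    rewrite length_map in Hi; exists i; split; trivial.
    rewrite Hw by trivial; exact E.
Qed.

Lemma phi_iff e x y :
  phi e x y <->
  exists w, (forall i, i < pi1 w ->
               justified (listed w) (pi1 (entry (pi2 w) i))
                 (pi1 (pi2 (entry (pi2 w) i))) (pi2 (pi2 (entry (pi2 w) i)))) /\
            listed w e x y.
Proof.
  split.
  - intros (c & <- & Hx); destruct (eval_certificate c x y Hx) as (L & HL & Hin).
    destruct (listed_list L) as [w Hw]; exists w; split; [|now apply Hw].
    intros i Hi; apply (justified_mono (holds_in L)); [intros; now apply Hw|].
    apply HL, Hw; exists i; split; trivial; unfold triple; now rewrite !cpair_pi.
  - intros (w & HJ & Hx); revert Hx; apply justified_phi; clear - HJ.
    intros e x y (i & Hi & E); specialize (HJ i Hi); rewrite E in HJ.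
    unfold triple in HJ; now rewrite !pi2_cpair, !pi1_cpair in HJ.
Qed.

Lemma semidec_listed w e x y :
  computable w -> computable e -> computable x -> computable y ->
  semidec (fun p => listed (w p) (e p) (x p) (y p)).
Proof.
  intros Hw He Hx Hy; apply semidec_computable_set.
  apply (computable_set_bex (fun p => pi1 (w p))
    (fun p i => entry (pi2 (w p)) i = triple (e p) (x p) (y p))); [comp|].
  unfold triple.
  assert (H : forall f, computable f -> computable (fun q => f (pi1 q)))
    by (intros f Hf; apply (computable_comp f); comp).
  comp.
Qed.

#[local] Hint Resolve semidec_listed : comp.

Lemma semidec_phi e x y :
  computable e -> computable x -> computable y ->
  semidec (fun p => phi (e p) (x p) (y p)).
Proof.
  intros He Hx Hy.
  apply semidec_ext with
    (fun p => phi (pi1 (triple (e p) (x p) (y p)))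
                  (pi1 (pi2 (triple (e p) (x p) (y p))))
                  (pi2 (pi2 (triple (e p) (x p) (y p))))).
  { intros p; unfold triple; now rewrite !pi2_cpair, !pi1_cpair. }
  apply (semidec_comp (fun t => phi (pi1 t) (pi1 (pi2 t)) (pi2 (pi2 t))));
    [|unfold triple; comp].
  eapply semidec_ext; [intros t; symmetry; apply phi_iff|].
  apply (semidec_ex (fun t w => (forall i, i < pi1 w ->
    justified (listed w) (pi1 (entry (pi2 w) i))
      (pi1 (pi2 (entry (pi2 w) i))) (pi2 (pi2 (entry (pi2 w) i)))) /\
    listed w (pi1 t) (pi1 (pi2 t)) (pi2 (pi2 t)))).
  apply semidec_and; [|comp].
  apply (semidec_ball (fun q => pi1 (pi2 q)) (fun q i =>
    justified (listed (pi2 q)) (pi1 (entry (pi2 (pi2 q)) i))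
      (pi1 (pi2 (entry (pi2 (pi2 q)) i))) (pi2 (pi2 (entry (pi2 (pi2 q)) i)))));
    [comp|].
  unfold justified.
  repeat apply semidec_or; comp.
Qed.

(** * Homogeneity of trees as a condition on numbers of children *)

(** [a] and [b] have the same first ancestor in [C], at the same distance. *)
Inductive sim (f : nat -> nat) (C : nat -> Prop) : nat -> nat -> Prop :=
| sim_here a : C a -> sim f C a a
| sim_up a b : ~ C a -> ~ C b -> sim f C (f a) (f b) -> sim f C a b.

(** At least [n] children. The root counts as a child of itself, which does not
    disturb comparisons over a set containing the root: there the root is similar
    only to itself. *)
Definition fan (f : nat -> nat) (n a : nat) : Prop :=
  exists l, NoDup l /\ length l = n /\ forall x, In x l -> f x = a.

Definition balanced (f : nat -> nat) (C : nat -> Prop) : Prop :=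
  forall a b n, sim f C a b -> fan f n a -> fan f n b.

(** Ultrahomogeneity is the case of the empty [C], and weak ultrahomogeneity asks
    for some finite [C]. *)
Definition homogeneous_over (f : nat -> nat) (eps : nat) (C : nat -> Prop) : Prop :=
  forall S S' h,
    fg_substructure f eps S -> fg_substructure f eps S' ->
    (forall a, C a -> S a /\ S' a /\ h a = a) ->
    isomorphism f eps S S' h ->
    extends_to_automorphism f eps S h.

Lemma sim_path f C a b :
  sim f C a b <->
  exists k, Nat.iter k f a = Nat.iter k f b /\ C (Nat.iter k f a) /\
    forall j, j < k -> ~ C (Nat.iter j f a) /\ ~ C (Nat.iter j f b).
Proof.
  split.
  - induction 1 as [a Ha|a b Ha Hb _ (k & E & Hk & Hj)].
    + exists 0; repeat split; trivial; lia.
    + exists (S k); rewrite !Nat.iter_succ_r; repeat split; trivial;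
        destruct j as [|j]; trivial; rewrite Nat.iter_succ_r; apply Hj; lia.
  - intros (k & E & Hk & Hj); revert a b E Hk Hj.
    induction k as [|k IH]; intros a b E Hk Hj.
    + cbn in E; subst b; now apply sim_here.
    + apply sim_up; [apply (Hj 0)|apply (Hj 0)|]; try lia.
      rewrite !Nat.iter_succ_r in E; rewrite Nat.iter_succ_r in Hk.
      apply IH; trivial.
      intros j Hlt; specialize (Hj (S j) ltac:(lia)).
      now rewrite !Nat.iter_succ_r in Hj.
Qed.

Section Homogeneity.

Context (f : nat -> nat) (eps : nat) (Htree : is_tree f eps).

Lemma root_fixed : f eps = eps.
Proof. apply Htree. Qed.

Lemma iter_root k : Nat.iter k f eps = eps.
Proof. induction k as [|k IH]; trivial; rewrite Nat.iter_succ, IH; apply root_fixed. Qed.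

Lemma tree_ind (P : nat -> Prop) :
  P eps -> (forall a, P (f a) -> P a) -> forall a, P a.
Proof.
  intros H0 HS a; destruct Htree as (_ & Hr & _); destruct (Hr a) as [n Hn].
  revert a Hn; induction n as [|n IH]; intros a Hn; [cbn in Hn; now subst a|].
  rewrite Nat.iter_succ_r in Hn; auto.
Qed.

Lemma sim_refl (C : nat -> Prop) a : C eps -> sim f C a a.
Proof.
  intros H0; induction a as [|a IH] using tree_ind; [now apply sim_here|].
  destruct (classic (C a)); [now apply sim_here|now apply sim_up].
Qed.

(** From a common ancestor on, two chains coincide; so a common first ancestor in
    the larger set leads to one in the smaller set, at equal distances. *)
Lemma balanced_mono (C C' : nat -> Prop) :
  C eps -> (forall x, C x -> C' x) -> balanced f C -> balanced f C'.
Proof.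
  intros H0 HC HB a b n Hs; apply HB; clear - Htree Hs HC H0.
  induction Hs; [now apply sim_refl|apply sim_up; auto].
Qed.

Definition closure (C : nat -> Prop) (x : nat) : Prop :=
  x = eps \/ exists a k, C a /\ x = Nat.iter k f a.

Lemma closure_step C x : closure C x -> closure C (f x).
Proof.
  intros [->|(a & k & Ha & ->)]; [left; apply root_fixed|right].
  now exists a, (S k).
Qed.

(** An isomorphism that fixes [C] fixes the substructure that [C] generates. *)
Lemma homogeneous_over_closure C :
  homogeneous_over f eps (closure C) <-> homogeneous_over f eps C.
Proof.
  split; intros H S S' h HS HS' Hh Hiso; apply (H S S'); trivial.
  - destruct HS as (S0 & SS & _), HS' as (S0' & SS' & _).
    destruct Hiso as (_ & _ & _ & Hf & H0).
    intros x [->|(a & k & Ha & ->)]; [auto|].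
    destruct (Hh a Ha) as (Sa & Sa' & E).
    induction k as [|k IH]; [auto|]; rewrite Nat.iter_succ; destruct IH as (I1 & I2 & I3).
    repeat split; auto; rewrite Hf, I3; auto.
  - intros a Ha; apply Hh; right; now exists a, 0.
Qed.

Lemma closure_finite l :
  exists L, forall x, closure (fun y => In y l) x <-> In x L.
Proof.
  induction l as [|a l (L & HL)].
  - exists [eps]; intros x; cbn; split; [|intros [->|[]]; now left].
    intros [->|(a & k & [] & _)]; auto.
  - destruct Htree as (_ & Hr & _); destruct (Hr a) as [n Hn].
    exists (L ++ map (fun k => Nat.iter k f a) (seq 0 n)); intros x.
    rewrite in_app_iff, <- HL, in_map_iff; split.
    + intros [->|(b & k & [<-|Hb] & ->)]; [left; now left| |left; right; eauto].
      destruct (lt_dec k n) as [Hk|Hk].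
      * right; exists k; split; trivial; apply in_seq; lia.
      * left; left; replace k with ((k - n) + n) by lia.
        now rewrite Nat.iter_add, Hn, iter_root.
    + intros [[->|(b & k & Hb & ->)]|(k & <- & _)]; [now left| |]; right.
      * exists b, k; cbn; auto.
      * exists a, k; cbn; auto.
Qed.

(** The chains from [a] and from [b] down to their common first ancestor in [C]
    are isomorphic over [C], and an automorphism extending that isomorphism
    carries children of [a] to children of [b]. *)
Lemma balanced_of_homogeneous (C : nat -> Prop) :
  C eps -> (forall x, C x -> C (f x)) -> (exists L, forall x, C x <-> In x L) ->
  homogeneous_over f eps C -> balanced f C.
Proof.
  intros H0 HS [L HL] HC a b n Hs (l & Hl & Hn & Hf).
  apply sim_path in Hs as (k & Ek & Hk & Hj).
  assert (Sub : forall c, C (Nat.iter k f c) -> fg_substructure f eps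
            (fun x => C x \/ exists j, j < k /\ x = Nat.iter j f c)).
  { intros c Hc; split; [now left|split].
    - intros x [Hx|(j & Hlt & ->)]; [left; auto|].
      destruct (Nat.eq_dec (S j) k) as [<-|Hne]; [now left|].
      right; exists (S j); split; [lia|reflexivity].
    - exists (L ++ map (fun j => Nat.iter j f c) (seq 0 k)); intros x.
      rewrite in_app_iff, <- HL, in_map_iff; split; (intros [Hx|H]; [now left|right]).
      + destruct H as (j & Hlt & ->); exists j; split; trivial; apply in_seq; lia.
      + destruct H as (j & <- & Hlt); apply in_seq in Hlt.
        exists j; split; [lia|trivial]. }
  assert (Inj : forall c i j, i < k -> j < k -> ~ C (Nat.iter i f c) ->
            Nat.iter i f c = Nat.iter j f c -> i = j).
  { intros c i j Hi Hlt Hc E; destruct (Nat.eq_dec i j) as [|Hne]; trivial.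
    destruct Htree as (_ & _ & Hcyc); apply Hcyc in E as E'; trivial.
    exfalso; apply Hc; now rewrite E, E'. }
  set (pos := fun x => epsilon (inhabits 0)
                (fun j => j < k /\ x = Nat.iter j f a)).
  assert (Hpos : forall j, j < k -> pos (Nat.iter j f a) = j).
  { intros j Hlt.
    destruct (epsilon_spec (inhabits 0)
      (fun i => i < k /\ Nat.iter j f a = Nat.iter i f a)) as [H1 H2]; [eauto|].
    fold (pos (Nat.iter j f a)) in H1, H2; symmetry.
    now apply (Inj a); trivial; apply Hj. }
  set (h := fun x => if excluded_middle_informative (C x) then x
                     else Nat.iter (pos x) f b).
  assert (hC : forall x, C x -> h x = x).
  { intros x Hx; unfold h; now destruct (excluded_middle_informative (C x)). }
  assert (hj : forall j, j <= k -> h (Nat.iter j f a) = Nat.iter j f b).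
  { intros j Hle; destruct (Nat.eq_dec j k) as [->|Hne]; [now rewrite hC|].
    unfold h; destruct (excluded_middle_informative (C (Nat.iter j f a))) as [H|H].
    - exfalso; revert H; apply Hj; lia.
    - now rewrite Hpos by lia. }
  assert (Iso : isomorphism f eps
            (fun x => C x \/ exists j, j < k /\ x = Nat.iter j f a)
            (fun x => C x \/ exists j, j < k /\ x = Nat.iter j f b) h).
  { split; [|split; [|split; [|split]]].
    - intros x [Hx|(j & Hlt & ->)]; [left; now rewrite hC|].
      right; exists j; split; trivial; apply hj; lia.
    - intros x y [Hx|(i & Hi & ->)] [Hy|(j & Hlt & ->)].
      + now rewrite (hC x), (hC y).
      + rewrite (hC x), (hj j) by auto with arith; intros ->.
        now destruct (Hj j Hlt).
      + rewrite (hC y), (hj i) by auto with arith; intros <-.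
        now destruct (Hj i Hi).
      + rewrite (hj i), (hj j) by auto with arith; intros E.
        apply Inj in E as ->; trivial; now apply Hj.
    - intros y [Hy|(j & Hlt & ->)]; [exists y; auto|].
      exists (Nat.iter j f a); split; [right; eauto|apply hj; lia].
    - intros x [Hx|(j & Hlt & ->)]; [rewrite !hC; auto|].
      rewrite (hj j) by lia; apply (hj (S j)); lia.
    - now apply hC. }
  destruct (HC _ _ h (Sub a Hk) (Sub b ltac:(now rewrite <- Ek))) as (g & Hg & Hgh);
    [auto|exact Iso|].
  assert (Eg : g a = b).
  { rewrite Hgh; [apply (hj 0); lia|].
    destruct k as [|k]; [now left|right; exists 0; split; [lia|trivial]]. }
  destruct Hg as (_ & Hinj & _ & Hcom & _).
  exists (map g l); split; [|split].
  - apply NoDup_map_NoDup_ForallPairs; trivial; intros x y _ _; now apply Hinj.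
  - now rewrite length_map.
  - intros y Hy; apply in_map_iff in Hy as (x & <- & Hx).
    rewrite <- Hcom, Hf; trivial.
Qed.

(** Finite partial automorphisms over [C], as lists of pairs. *)
Definition partial_iso (C : nat -> Prop) (L : list (nat * nat)) : Prop :=
  In (eps, eps) L /\
  (forall x y, In (x, y) L -> In (f x, f y) L) /\
  (forall x y x' y', In (x, y) L -> In (x', y') L -> (x = x' <-> y = y')) /\
  (forall c, C c -> In (c, c) L).

Definition swap (p : nat * nat) : nat * nat := (snd p, fst p).

Lemma in_swap L x y : In (x, y) (map swap L) <-> In (y, x) L.
Proof.
  rewrite in_map_iff; split.
  - intros ([u v] & E & H); now injection E as <- <-.
  - intros H; now exists (y, x).
Qed.

Lemma partial_iso_swap C L : partial_iso C L -> partial_iso C (map swap L).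
Proof.
  intros (L0 & LS & LF & LC); split; [|split; [|split]].
  - now apply in_swap.
  - intros x y H; apply in_swap, LS; now apply in_swap.
  - intros x y x' y' H H'; rewrite in_swap in H, H'.
    specialize (LF _ _ _ _ H H'); tauto.
  - intros c Hc; apply in_swap; auto.
Qed.

(** The chains from a node and from its image stay matched, and they enter [C]
    together, because [C] is fixed and matching is injective. *)
Lemma partial_iso_sim (C : nat -> Prop) L x y :
  C eps -> partial_iso C L -> In (x, y) L -> sim f C x y.
Proof.
  intros H0 (L0 & LS & LF & LC); revert y.
  induction x as [|x IH] using tree_ind; intros y H.
  - assert (y = eps) as -> by now apply (LF _ _ _ _ H L0).
    now apply sim_here.
  - destruct (classic (C x)) as [Hx|Hx].
    + assert (x = y) as <- by now apply (LF _ _ _ _ (LC x Hx) H).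
      now apply sim_here.
    + apply sim_up; auto; intros Hy; apply Hx.
      assert (x = y) as -> by (apply (LF _ _ _ _ H (LC y Hy)); trivial); trivial.
Qed.

(** The children of [f a] in the domain are as many as the children of its
    image in the range. As [f a] has one more child, so has its image, which
    leaves a value for [a]. *)
Lemma partial_iso_extend (C : nat -> Prop) L a d :
  C eps -> balanced f C -> partial_iso C L -> In (f a, d) L ->
  exists b, exists L', incl L L' /\ partial_iso C L' /\ In (a, b) L'.
Proof.
  intros H0 HB HL Hd.
  destruct (classic (exists b, In (a, b) L)) as [[b Hb]|Ha].
  { exists b, L; split; [apply incl_refl|auto]. }
  assert (Hs : sim f C (f a) d) by now apply (partial_iso_sim C L).
  pose proof HL as (L0 & LS & LF & LC).
  set (M := filter (fun p => f (fst p) =? f a)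
              (nodup (fun p q : nat * nat => ltac:(repeat decide equality)) L)).
  assert (HM : forall p, In p M <-> In p L /\ f (fst p) = f a).
  { intros p; unfold M; rewrite filter_In, nodup_In, Nat.eqb_eq; tauto. }
  assert (ND : NoDup (map fst M)).
  { apply NoDup_map_NoDup_ForallPairs; [|apply NoDup_filter, NoDup_nodup].
    intros [x y] [x' y'] H H' E; cbn in E; subst x'.
    apply HM in H as [H _], H' as [H' _]; f_equal; now apply (LF _ _ _ _ H H'). }
  destruct (HB _ _ (S (length M)) Hs) as (l & Hl & Hn & Hf).
  { exists (a :: map fst M); split; [|split].
    - constructor; trivial; intros Hin; apply in_map_iff in Hin as ([x y] & E & H).
      cbn in E; subst x; apply HM in H as [H _]; eauto.
    - cbn; now rewrite length_map.
    - intros x [<-|Hx]; trivial; apply in_map_iff in Hx as (p & <- & Hp).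
      now apply HM. }
  assert (Hb : exists b, In b l /\ ~ exists x, In (x, b) L).
  { apply NNPP; intros Hno.
    enough (length l <= length (map snd M)) by (rewrite length_map in *; lia).
    apply NoDup_incl_length; trivial; intros b Hb.
    destruct (classic (exists x, In (x, b) L)) as [[x Hx]|Hx];
      [|exfalso; eauto].
    apply in_map_iff; exists (x, b); split; trivial; apply HM; split; trivial.
    apply LS in Hx; rewrite (Hf b Hb) in Hx; now apply (LF _ _ _ _ Hx Hd). }
  destruct Hb as (b & Hb & Hfresh).
  exists b, ((a, b) :: L); split; [now apply incl_tl, incl_refl|].
  split; [|now left]; split; [now right|split; [|split]].
  - intros x y [E|H]; right; [injection E as <- <-|auto].
    now rewrite (Hf b Hb).
  - intros x y x' y' [E|H] [E'|H'].
    + injection E as <- <-; injection E' as <- <-; tauto.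
    + injection E as <- <-; split; intros ->; exfalso; eauto.
    + injection E' as <- <-; split; intros ->; exfalso; eauto.
    + exact (LF _ _ _ _ H H').
  - intros c Hc; right; auto.
Qed.

Lemma partial_iso_forth (C : nat -> Prop) L a :
  C eps -> balanced f C -> partial_iso C L ->
  exists b, exists L', incl L L' /\ partial_iso C L' /\ In (a, b) L'.
Proof.
  intros H0 HB HL; induction a as [|a (d & L' & Hi & HL' & Hd)] using tree_ind.
  - exists eps, L; split; [apply incl_refl|]; split; trivial; exact (proj1 HL).
  - destruct (partial_iso_extend C L' a d H0 HB HL' Hd) as (b & L'' & Hi' & H).
    exists b, L''; split; trivial; now apply incl_tran with L'.
Qed.

Lemma partial_iso_back (C : nat -> Prop) L b :
  C eps -> balanced f C -> partial_iso C L ->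
  exists a, exists L', incl L L' /\ partial_iso C L' /\ In (a, b) L'.
Proof.
  intros H0 HB HL.
  destruct (partial_iso_forth C (map swap L) b H0 HB (partial_iso_swap C L HL))
    as (a & L' & Hi & HL' & Hb).
  exists a, (map swap L'); split; [|split].
  - intros [x y] H; apply in_swap, Hi, in_swap, H.
  - now apply partial_iso_swap.
  - now apply in_swap.
Qed.

(** Back and forth: step [n] puts [n] into the domain and into the range. *)
Lemma partial_iso_automorphism (C : nat -> Prop) L :
  C eps -> balanced f C -> partial_iso C L ->
  exists g, automorphism f eps g /\ forall x y, In (x, y) L -> g x = y.
Proof.
  intros H0 HB HL.
  assert (Hstep : forall p : list (nat * nat) * nat, exists L', partial_iso C (fst p) ->
            incl (fst p) L' /\ partial_iso C L' /\
            (exists b, In (snd p, b) L') /\ (exists a, In (a, snd p) L')).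
  { intros [L1 n]; cbn; destruct (classic (partial_iso C L1)) as [H|H];
      [|exists []; tauto].
    destruct (partial_iso_forth C L1 n H0 HB H) as (b & L2 & I2 & P2 & Hb).
    destruct (partial_iso_back C L2 n H0 HB P2) as (a & L3 & I3 & P3 & Ha).
    exists L3; intros _; split; [now apply incl_tran with L2|]; split; trivial.
    split; [exists b; now apply I3|now exists a]. }
  apply functional_choice in Hstep as [next Hnext].
  set (chain := nat_rect (fun _ => list (nat * nat)) L (fun n Ln => next (Ln, n))).
  assert (Hchain : forall n, partial_iso C (chain n)).
  { intros n; induction n as [|n IH]; trivial.
    exact (proj1 (proj2 (Hnext (chain n, n) IH))). }
  assert (Hmono : forall m n, m <= n -> incl (chain m) (chain n)).
  { intros m n Hle; induction Hle as [|n Hle IH]; [apply incl_refl|].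
    apply incl_tran with (chain n); trivial.
    exact (proj1 (Hnext (chain n, n) (Hchain n))). }
  set (G := fun x y => exists n, In (x, y) (chain n)).
  assert (GF : forall x y x' y', G x y -> G x' y' -> (x = x' <-> y = y')).
  { intros x y x' y' [m Hm] [n Hn].
    apply (Hmono m (max m n)) in Hm; [|lia]; apply (Hmono n (max m n)) in Hn; [|lia].
    destruct (Hchain (max m n)) as (_ & _ & LF & _); exact (LF _ _ _ _ Hm Hn). }
  assert (Gdom : forall x, exists y, G x y).
  { intros x; destruct (Hnext (chain x, x) (Hchain x)) as (_ & _ & [y Hy] & _).
    exists y, (S x); exact Hy. }
  apply functional_choice in Gdom as [g Hg].
  assert (Ggr : forall x y, G x y -> g x = y).
  { intros x y H; now apply (GF _ _ _ _ (Hg x) H). }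
  exists g; split; [split; [|split; [|split; [|split]]]|].
  - trivial.
  - intros x y _ _ E; now apply (GF _ _ _ _ (Hg x) (Hg y)).
  - intros y _; destruct (Hnext (chain y, y) (Hchain y)) as (_ & _ & _ & [x Hx]).
    exists x; split; trivial; apply Ggr; exists (S y); exact Hx.
  - intros x _; apply Ggr; destruct (Hg x) as [n Hn]; exists n.
    now apply (proj1 (proj2 (Hchain n))).
  - apply Ggr; exists 0; exact (proj1 HL).
  - intros x y H; apply Ggr; now exists 0.
Qed.

Lemma homogeneous_of_balanced (C : nat -> Prop) :
  C eps -> balanced f C -> homogeneous_over f eps C.
Proof.
  intros H0 HB S S' h (S0 & SS & l & Hl) _ Hh (_ & Hinj & _ & Hf & He).
  destruct (partial_iso_automorphism C (map (fun x => (x, h x)) l)) as (g & Hg & Hgh);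
    trivial.
  - assert (HP : forall x y, In (x, y) (map (fun x => (x, h x)) l) <-> S x /\ y = h x).
    { intros x y; rewrite in_map_iff, Hl; split.
      - intros (z & E & Hz); now injection E as <- <-.
      - intros [Hx ->]; now exists x. }
    split; [|split; [|split]].
    + now apply HP.
    + intros x y H; apply HP in H as [Hx ->]; apply HP; split; auto.
      symmetry; auto.
    + intros x y x' y' H H'; apply HP in H as [Hx ->], H' as [Hx' ->].
      split; [now intros ->|auto].
    + intros c Hc; apply HP; destruct (Hh c Hc) as (Sc & _ & E); auto.
  - exists g; split; trivial; intros x Hx; apply Hgh, in_map_iff.
    exists x; split; trivial; now apply Hl.
Qed.

Lemma homogeneous_iff_balanced (C : nat -> Prop) :
  C eps -> (forall x, C x -> C (f x)) -> (exists L, forall x, C x <-> In x L) ->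
  homogeneous_over f eps C <-> balanced f C.
Proof.
  split; [now apply balanced_of_homogeneous|now apply homogeneous_of_balanced].
Qed.

Definition below (m x : nat) : Prop := x = eps \/ x < m.

Lemma ultrahomogeneous_iff : ultrahomogeneous f eps <-> balanced f (below 0).
Proof.
  assert (E : forall x, below 0 x <-> x = eps) by (unfold below; intros; lia).
  rewrite <- homogeneous_iff_balanced.
  - split; intros H S S' h HS HS'; [intros _; now apply (H S S')|].
    intros Hiso; apply (H S S'); trivial.
    intros a Ha; apply E in Ha as ->; repeat split;
      [apply HS|apply HS'|apply Hiso].
  - now apply E.
  - intros x Hx; apply E in Hx as ->; apply E, root_fixed.
  - exists [eps]; intros x; rewrite E; cbn; intuition.
Qed.

Lemma weakly_ultrahomogeneous_iff :
  weakly_ultrahomogeneous f eps <-> exists m, balanced f (below m).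
Proof.
  assert (Hl : forall l, homogeneous_over f eps (fun x => In x l) <->
                         balanced f (closure (fun x => In x l))).
  { intros l; rewrite <- homogeneous_over_closure.
    apply homogeneous_iff_balanced; [now left|apply closure_step|].
    apply closure_finite. }
  split.
  - intros [l H]; apply Hl in H; destruct (closure_finite l) as [L HL].
    exists (S (list_max L)); revert H; apply balanced_mono; [now left|].
    intros x Hx; right; apply HL in Hx.
    pose proof (proj1 (list_max_le L _) (le_n _)) as Hmax.
    rewrite Forall_forall in Hmax; specialize (Hmax x Hx); lia.
  - intros [m H]; exists (seq 0 m); apply Hl; revert H.
    apply balanced_mono; [now left|].
    intros x [->|Hx]; [now left|right]; exists x, 0; split; trivial.
    apply in_seq; lia.
Qed.

End Homogeneity.

(** * The index sets are in their classes *)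

Lemma phi_functional e x y y' : phi e x y -> phi e x y' -> y = y'.
Proof.
  intros (c & Ec & H) (c' & Ec' & H').
  rewrite (encode_inj c' c) in H' by congruence.
  exact (eval_functional _ _ _ _ H H').
Qed.

Lemma computes_phi e f x y : computes e f -> phi e x y <-> f x = y.
Proof.
  intros He; split; [|intros <-; apply He].
  intros H; exact (phi_functional _ _ _ _ (He x) H).
Qed.

Lemma B_is_iff eps P e f :
  computes e f -> is_tree f eps -> B_is eps P e <-> P f eps.
Proof.
  intros He Ht; split; [|now exists f].
  intros (g & Hg & _ & HP).
  replace f with g; trivial; apply functional_extensionality; intros x.
  exact (phi_functional _ _ _ _ (Hg x) (He x)).
Qed.

(** [sim] and [fan] are witnessed by finite sequences of values of the
    predecessor function; in this form they make sense for every program. *)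
Definition sim_index (eps e m a b : nat) : Prop :=
  exists u v k, entry u 0 = a /\ entry v 0 = b /\
    (forall j, j < k ->
       phi e (entry u j) (entry u (S j)) /\ phi e (entry v j) (entry v (S j)) /\
       ~ below eps m (entry u j) /\ ~ below eps m (entry v j)) /\
    entry u k = entry v k /\ below eps m (entry u k).

Definition fan_index (e n a : nat) : Prop :=
  exists w, (forall i, i < n -> phi e (entry w i) a) /\
            (forall i, i < n -> forall j, j < i -> entry w i <> entry w j).

Lemma sim_index_iff eps e f m a b :
  computes e f -> sim_index eps e m a b <-> sim f (below eps m) a b.
Proof.
  intros He; rewrite sim_path; split.
  - intros (u & v & k & <- & <- & Hj & E & Hk).
    assert (Hi : forall j, j <= k -> entry u j = Nat.iter j f (entry u 0) /\
                                     entry v j = Nat.iter j f (entry v 0)).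
    { induction j as [|j IH]; intros Hle; [now split|].
      destruct (IH ltac:(lia)) as [Iu Iv].
      destruct (Hj j Hle) as (Hu & Hv & _); rewrite !Nat.iter_succ, <- Iu, <- Iv.
      now rewrite computes_phi in Hu, Hv by exact He. }
    destruct (Hi k (le_n _)) as [Iu Iv]; rewrite Iu, Iv in E; rewrite Iu in Hk.
    exists k; repeat split; trivial; destruct (Hj j H) as (_ & _ & Hu & Hv);
      destruct (Hi j) as [Iu' Iv']; try lia; congruence.
  - intros (k & E & Hk & Hj).
    destruct (entry_surj (fun j => Nat.iter j f a) (S k)) as [u Hu].
    destruct (entry_surj (fun j => Nat.iter j f b) (S k)) as [v Hv].
    exists u, v, k; rewrite !Hu, !Hv by lia; repeat split; trivial;
      rewrite ?Hu, ?Hv by lia; try (now apply Hj).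
    + rewrite Nat.iter_succ; apply He.
    + rewrite Nat.iter_succ; apply He.
Qed.

Lemma fan_index_iff e f n a : computes e f -> fan_index e n a <-> fan f n a.
Proof.
  intros He; split.
  - intros (w & Hw & Hinj); exists (map (entry w) (seq 0 n)); split; [|split].
    + apply NoDup_map_NoDup_ForallPairs; [|apply seq_NoDup].
      intros i j Hi Hj E; apply in_seq in Hi, Hj.
      destruct (lt_eq_lt_dec i j) as [[H|H]|H]; trivial; exfalso.
      * apply (Hinj j ltac:(lia) i H); auto.
      * apply (Hinj i ltac:(lia) j H); auto.
    + now rewrite length_map, length_seq.
    + intros x Hx; apply in_map_iff in Hx as (i & <- & Hi); apply in_seq in Hi.
      apply (computes_phi e); trivial; apply Hw; lia.
  - intros (l & Hl & <- & Hf).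
    destruct (entry_surj (fun i => nth i l 0) (length l)) as [w Hw].
    exists w; split.
    + intros i Hi; rewrite Hw by trivial; apply (computes_phi e f); trivial.
      now apply Hf, nth_In.
    + intros i Hi j Hj; rewrite !Hw by lia; intros E.
      apply (proj1 (NoDup_nth l 0) Hl) in E; lia.
Qed.

Lemma semidec_below eps m x :
  computable m -> computable x ->
  computable_set (fun p => below eps (m p) (x p)).
Proof. intros Hm Hx; unfold below; comp. Qed.

#[local] Hint Resolve semidec_phi semidec_below : comp.

Definition balanced_index (eps p : nat) : Prop :=
  forall t,
    sim_index eps (pi1 p) (pi2 p) (pi1 t) (pi1 (pi2 t)) /\
      fan_index (pi1 p) (pi2 (pi2 t)) (pi1 t) ->
    fan_index (pi1 p) (pi2 (pi2 t)) (pi1 (pi2 t)).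

Lemma balanced_index_iff eps e f m :
  computes e f -> balanced_index eps (cpair e m) <-> balanced f (below eps m).
Proof.
  intros He; unfold balanced_index; rewrite pi1_cpair, pi2_cpair; split.
  - intros H a b n Hs Ha; specialize (H (cpair a (cpair b n))).
    repeat rewrite ?pi1_cpair, ?pi2_cpair in H.
    apply (fan_index_iff e); trivial; apply H.
    now rewrite sim_index_iff, fan_index_iff by exact He.
  - intros H t [Hs Ha]; apply (sim_index_iff _ _ f) in Hs; trivial.
    apply (fan_index_iff _ f) in Ha; trivial; apply (fan_index_iff _ f); trivial.
    exact (H _ _ _ Hs Ha).
Qed.

(** A witness of the hypothesis becomes part of the universal quantifier; the
    negation of its verification is decidable. *)
Lemma Pi2_forall_imp A B :
  semidec (fun q => A (pi1 q) (pi2 q)) -> semidec (fun q => B (pi1 q) (pi2 q)) ->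
  Pi0 2 (fun p => forall t, A p t -> B p t).
Proof.
  intros (R & HR & Hx) HB.
  exists (fun q => ~ R (cpair (cpair (pi1 q) (pi1 (pi2 q))) (pi2 (pi2 q))) \/
                   B (pi1 q) (pi1 (pi2 q))); split.
  - apply semidec_or.
    + apply semidec_computable_set, computable_set_not, computable_set_comp; comp.
    + apply semidec_ext with (fun q => B (pi1 (cpair (pi1 q) (pi1 (pi2 q))))
                                         (pi2 (cpair (pi1 q) (pi1 (pi2 q))))).
      * intros q; now rewrite pi1_cpair, pi2_cpair.
      * apply (semidec_comp (fun q => B (pi1 q) (pi2 q))); comp.
  - intros p; split.
    + intros H y; rewrite pi1_cpair, pi2_cpair.
      destruct (classic (R (cpair (cpair p (pi1 y)) (pi2 y)))) as [Hr|Hr]; auto.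
      right; apply H; specialize (Hx (cpair p (pi1 y))).
      rewrite pi1_cpair, pi2_cpair in Hx; apply Hx; eauto.
    + intros H t Ha; specialize (Hx (cpair p t)).
      rewrite pi1_cpair, pi2_cpair in Hx; apply Hx in Ha as [y Hy].
      specialize (H (cpair t y)); repeat rewrite ?pi1_cpair, ?pi2_cpair in H; tauto.
Qed.

Lemma Pi2_balanced_index eps : Pi0 2 (balanced_index eps).
Proof.
  apply (Pi2_forall_imp
    (fun p t => sim_index eps (pi1 p) (pi2 p) (pi1 t) (pi1 (pi2 t)) /\
                fan_index (pi1 p) (pi2 (pi2 t)) (pi1 t))
    (fun p t => fan_index (pi1 p) (pi2 (pi2 t)) (pi1 (pi2 t))));
  unfold sim_index, fan_index; comp.
Qed.

Lemma Pi2_comp A f : Pi0 2 A -> computable f -> Pi0 2 (fun p => A (f p)).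
Proof.
  intros (R & HR & Hx) Hf; exists (fun q => R (cpair (f (pi1 q)) (pi2 q))); split.
  - apply (semidec_comp R); trivial; apply computable_cpair; comp.
    apply (computable_comp f); comp.
  - intros x; rewrite Hx; split; intros H y; specialize (H y); revert H;
      now rewrite pi1_cpair, pi2_cpair.
Qed.

Lemma UHP_upper eps :
  exists R, Pi0 2 R /\ forall e, UHP eps e <-> TRP eps e /\ R e.
Proof.
  exists (fun e => balanced_index eps (cpair e 0)); split.
  - apply (Pi2_comp (balanced_index eps)); [apply Pi2_balanced_index|comp].
  - assert (H : forall e f, computes e f -> is_tree f eps ->
              balanced_index eps (cpair e 0) <-> ultrahomogeneous f eps).
    { intros e f He Ht; now rewrite (balanced_index_iff _ _ f), ultrahomogeneous_iff. }
    intros e; split.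
    + intros (f & He & Ht & HU); split; [now exists f|now apply (H e f)].
    + intros [(f & He & Ht & _) HR]; exists f; repeat split; try apply Ht; trivial.
      now apply (H e f).
Qed.

Lemma WUP_upper eps :
  exists R, Sigma0 3 R /\ forall e, WUP eps e <-> TRP eps e /\ R e.
Proof.
  exists (fun e => exists m, balanced_index eps (cpair e m)); split.
  - exists (balanced_index eps); split; [apply Pi2_balanced_index|reflexivity].
  - assert (H : forall e f, computes e f -> is_tree f eps ->
              (exists m, balanced_index eps (cpair e m)) <->
              weakly_ultrahomogeneous f eps).
    { intros e f He Ht; rewrite weakly_ultrahomogeneous_iff by trivial.
      now setoid_rewrite (balanced_index_iff eps e f). }
    intros e; split.
    + intros (f & He & Ht & HU); split; [now exists f|now apply (H e f)].
    + intros [(f & He & Ht & _) HR]; exists f; repeat split; try apply Ht; trivial.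
      now apply (H e f).
Qed.

(** * Programs with a parameter built in *)

Fixpoint const_code (i : nat) : code :=
  match i with 0 => Zero | S i => Comp Succ (const_code i) end.

Lemma eval_const_code i x : eval (const_code i) x i.
Proof. induction i as [|i IH]; [reflexivity|exists i; now split]. Qed.

(** A parameter is built into a program as a numeral, so the program number is
    obtained from the parameter by iterating an arithmetic function. *)
Lemma computable_smn F :
  computable F ->
  exists s, computable s /\ forall i, computes (s i) (fun n => F (cpair i n)).
Proof.
  intros HF; apply computable_iff in HF as [c Hc].
  exists (fun i => encode (Comp c (Pair (const_code i) (Pair Fst Snd)))); split.
  - assert (HK : computable (fun i => encode (const_code i))).
    { apply computable_ext with (f := fun i =>
        nat_rec (fun _ => nat) 0 (fun _ z => 5 + 4 * cpair 1 z) i).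
      - intros i; induction i as [|i IH]; [reflexivity|].
        exact (f_equal (fun z => 5 + 4 * cpair 1 z) IH).
      - apply (computable_rec (fun _ => 0) (fun _ _ z => 5 + 4 * cpair 1 z)); comp. }
    cbn [encode]; comp.
  - intros i n; eexists; split; [reflexivity|].
    exists (cpair i n); split; [|apply Hc].
    exists i, n; split; [apply eval_const_code|split; trivial].
    exists (pi1 n), (pi2 n); repeat split; symmetry; apply cpair_pi.
Qed.

(** * Trees with prescribed fans at the first level *)

Definition branch (eps x : nat) : nat := S eps + cpair x 0.
Definition leaf (eps x s : nat) : nat := S eps + cpair x (S s).

(** Branches hang from the root; the leaf [(x, s)] hangs from branch [x] if
    [Q x s] holds. All the remaining numbers hang from branch [0], which is
    thereby certain to have infinitely many children. *)
Record comb (eps : nat) (Q : nat -> nat -> Prop) (t : nat -> nat) : Prop := {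
  comb_root : t eps = eps;
  comb_low n : n < eps -> t n = branch eps 0;
  comb_branch x : t (branch eps x) = eps;
  comb_leaf x s : Q x s -> t (leaf eps x s) = branch eps x;
  comb_spare x s : ~ Q x s -> t (leaf eps x s) = branch eps 0 }.

Lemma branch_inj eps x y : branch eps x = branch eps y -> x = y.
Proof.
  unfold branch; intros E.
  destruct (cpair_inj x 0 y 0 ltac:(lia)) as [-> _]; trivial.
Qed.

Lemma leaf_inj eps x y s u : leaf eps x s = leaf eps y u -> x = y /\ s = u.
Proof.
  unfold leaf; intros E.
  destruct (cpair_inj x (S s) y (S u) ltac:(lia)) as [-> E']; auto.
Qed.

Lemma branch_ge eps x : x <= branch eps x.
Proof.
  unfold branch; pose proof (Cantor.to_nat_non_decreasing x 0).
  unfold cpair; lia.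
Qed.

Lemma comb_cases eps n :
  n < eps \/ n = eps \/ (exists x, n = branch eps x) \/
  (exists x s, n = leaf eps x s).
Proof.
  destruct (lt_eq_lt_dec n eps) as [[H|H]|H]; auto; do 2 right.
  assert (E : n = S eps + cpair (pi1 (n - S eps)) (pi2 (n - S eps)))
    by (rewrite cpair_pi; lia).
  destruct (pi2 (n - S eps)) as [|s]; [left|right]; eauto.
Qed.

Lemma comb_reduction eps (Q : nat -> nat -> nat -> Prop) :
  computable_set (fun q => Q (pi1 q) (pi1 (pi2 q)) (pi2 (pi2 q))) ->
  exists r, computable r /\ forall i, exists t, computes (r i) t /\ comb eps (Q i) t.
Proof.
  intros (chi & Hchi & HQ).
  set (F := fun q =>
    cond (eps - pi2 q) (branch eps 0)
     (cond (pi2 q - eps)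
       (cond (pi2 (pi2 q - S eps))
         (cond (chi (cpair (pi1 q) (cpair (pi1 (pi2 q - S eps))
                      (pred (pi2 (pi2 q - S eps))))))
            (branch eps (pi1 (pi2 q - S eps))) (branch eps 0))
         eps)
       eps)).
  assert (HF : computable F).
  { unfold F, branch; apply computable_cond; comp.
    apply computable_cond; comp; apply computable_cond; comp.
    apply computable_cond; comp.
    apply (computable_comp chi); comp. }
  apply computable_smn in HF as (r & Hr & Hcomp).
  exists r; split; trivial; intros i; exists (fun n => F (cpair i n)); split; trivial.
  assert (Hleaf : forall x s, F (cpair i (leaf eps x s)) =
            cond (chi (cpair i (cpair x s))) (branch eps x) (branch eps 0)).
  { intros x s; unfold F; rewrite pi1_cpair, pi2_cpair; unfold leaf.
    replace (eps - (S eps + cpair x (S s))) with 0 by lia.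
    replace (S eps + cpair x (S s) - eps) with (S (cpair x (S s))) by lia.
    replace (S eps + cpair x (S s) - S eps) with (cpair x (S s)) by lia.
    rewrite pi1_cpair, pi2_cpair; reflexivity. }
  assert (HQ' : forall x s, Q i x s /\ chi (cpair i (cpair x s)) = 1 \/
                            ~ Q i x s /\ chi (cpair i (cpair x s)) = 0).
  { intros x s; specialize (HQ (cpair i (cpair x s))).
    now repeat rewrite ?pi1_cpair, ?pi2_cpair in HQ. }
  split.
  - unfold F; rewrite pi2_cpair, Nat.sub_diag; reflexivity.
  - intros n Hn; unfold F; rewrite pi2_cpair.
    destruct (eps - n) eqn:E; [lia|reflexivity].
  - intros x; unfold F; rewrite pi2_cpair; unfold branch.
    replace (eps - (S eps + cpair x 0)) with 0 by lia.
    replace (S eps + cpair x 0 - S eps) with (cpair x 0) by lia.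
    replace (S eps + cpair x 0 - eps) with (S (cpair x 0)) by lia.
    rewrite pi2_cpair; reflexivity.
  - intros x s H; rewrite Hleaf; destruct (HQ' x s) as [[_ ->]|[H' _]];
      [reflexivity|contradiction].
  - intros x s H; rewrite Hleaf; destruct (HQ' x s) as [[H' _]|[_ ->]];
      [contradiction|reflexivity].
Qed.

(** Only the root can lie on a cycle, as a cycle contains all the later iterates
    of its members and the root is one of them. *)
Lemma is_tree_intro (f : nat -> nat) (eps : nat) :
  f eps = eps -> (forall a, exists n, Nat.iter n f a = eps) -> is_tree f eps.
Proof.
  intros H0 Hr.
  assert (Hroot : forall k, Nat.iter k f eps = eps).
  { intros k; induction k as [|k IH]; trivial; now rewrite Nat.iter_succ, IH. }
  assert (Hcyc : forall b d, 0 < d -> Nat.iter d f b = b -> b = eps).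
  { intros b d Hd E; destruct (Hr b) as [r Hb].
    assert (Eq : forall q, Nat.iter (q * d) f b = b).
    { intros q; induction q as [|q IH]; trivial.
      change (S q * d) with (d + q * d); now rewrite Nat.iter_add, IH. }
    rewrite <- (Eq r) at 1.
    replace (r * d) with ((r * d - r) + r) by nia.
    now rewrite Nat.iter_add, Hb. }
  assert (Hlt : forall a m n, m < n -> Nat.iter m f a = Nat.iter n f a ->
            Nat.iter n f a = eps).
  { intros a m n Hmn E; apply (Hcyc _ (n - m)); [lia|].
    rewrite <- E at 1; rewrite <- Nat.iter_add; f_equal; lia. }
  split; [|split]; trivial; intros a m n Hne E.
  destruct (lt_eq_lt_dec m n) as [[H|H]|H]; [eauto|contradiction|].
  rewrite <- E; symmetry in E; eauto.
Qed.

Section Comb.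

Context (eps : nat) (Q : nat -> nat -> Prop) (t : nat -> nat) (Ht : comb eps Q t).

Lemma comb_range n : t n = eps \/ exists x, t n = branch eps x.
Proof.
  destruct (comb_cases eps n) as [H|[->|[[x ->]|(x & s & ->)]]].
  - right; exists 0; now apply (comb_low _ _ _ Ht).
  - left; apply (comb_root _ _ _ Ht).
  - left; apply (comb_branch _ _ _ Ht).
  - right; destruct (classic (Q x s)) as [H|H].
    + exists x; now apply (comb_leaf _ _ _ Ht).
    + exists 0; now apply (comb_spare _ _ _ Ht).
Qed.

Lemma comb_tree : is_tree t eps.
Proof.
  apply is_tree_intro; [apply (comb_root _ _ _ Ht)|].
  intros a; exists 2; cbn; destruct (comb_range a) as [->|[x ->]].
  - apply (comb_root _ _ _ Ht).
  - apply (comb_branch _ _ _ Ht).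
Qed.

Lemma fan_unbounded g a :
  (forall s u, g s = g u -> s = u) -> (forall B, exists s, B <= s /\ t (g s) = a) ->
  forall n, fan t n a.
Proof.
  intros Hg Hs n.
  enough (H : exists l, NoDup l /\ length l = n /\ forall s, In s l -> t (g s) = a).
  { destruct H as (l & Hl & Hn & H); exists (map g l); split; [|split].
    - apply NoDup_map_NoDup_ForallPairs; trivial; intros x y _ _; apply Hg.
    - now rewrite length_map.
    - intros x Hx; apply in_map_iff in Hx as (s & <- & Hx); auto. }
  induction n as [|n (l & Hl & Hn & H)].
  { exists []; split; [apply NoDup_nil|now split]. }
  destruct (Hs (S (list_max l))) as (s & Hle & E).
  exists (s :: l); split; [constructor; trivial|split; [cbn; auto|]].
  - intros Hin; pose proof (proj1 (list_max_le l _) (le_n _)) as Hmax.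
    rewrite Forall_forall in Hmax; specialize (Hmax s Hin); lia.
  - intros u [<-|Hu]; auto.
Qed.

Lemma fan_branch_zero n : fan t n (branch eps 0).
Proof.
  apply fan_unbounded with (g := leaf eps 0).
  - intros s u E; now apply leaf_inj in E.
  - intros B; exists B; split; trivial; destruct (classic (Q 0 B)).
    + now apply (comb_leaf _ _ _ Ht).
    + now apply (comb_spare _ _ _ Ht).
Qed.

Lemma fan_branch x n :
  (forall B, exists s, B <= s /\ Q x s) -> fan t n (branch eps x).
Proof.
  intros H; apply fan_unbounded with (g := leaf eps x).
  - intros s u E; now apply leaf_inj in E.
  - intros B; destruct (H B) as (s & Hs & HQ); exists s; split; trivial.
    now apply (comb_leaf _ _ _ Ht).
Qed.

Lemma fan_branch_ge x n : (forall s, s < n -> Q x s) -> fan t n (branch eps x).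
Proof.
  intros H; exists (map (leaf eps x) (seq 0 n)); split; [|split].
  - apply NoDup_map_NoDup_ForallPairs; [|apply seq_NoDup].
    intros s u _ _ E; now apply leaf_inj in E.
  - now rewrite length_map, length_seq.
  - intros y Hy; apply in_map_iff in Hy as (s & <- & Hs); apply in_seq in Hs.
    apply (comb_leaf _ _ _ Ht), H; lia.
Qed.

Lemma fan_branch_le x n B :
  x <> 0 -> (forall s, Q x s -> s < B) -> fan t n (branch eps x) -> n <= B.
Proof.
  intros Hx HB (l & Hl & <- & Hf).
  replace B with (length (map (leaf eps x) (seq 0 B)))
    by now rewrite length_map, length_seq.
  apply NoDup_incl_length; trivial; intros y Hy; apply Hf in Hy.
  assert (N0 : branch eps 0 <> branch eps x)
    by (intros E; apply branch_inj in E; congruence).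
  assert (Nr : eps <> branch eps x) by (unfold branch; lia).
  destruct (comb_cases eps y) as [H|[->|[[z ->]|(z & s & ->)]]].
  - now rewrite (comb_low _ _ _ Ht) in Hy.
  - now rewrite (comb_root _ _ _ Ht) in Hy.
  - now rewrite (comb_branch _ _ _ Ht) in Hy.
  - destruct (classic (Q z s)) as [HQ|HQ].
    + rewrite (comb_leaf _ _ _ Ht) in Hy by trivial; apply branch_inj in Hy as ->.
      apply in_map, in_seq; apply HB in HQ; lia.
    + now rewrite (comb_spare _ _ _ Ht) in Hy by trivial.
Qed.

Lemma sim_branch m x y :
  m <= branch eps x -> m <= branch eps y ->
  sim t (below eps m) (branch eps x) (branch eps y).
Proof.
  intros Hx Hy; apply sim_up.
  - unfold below, branch in *; lia.
  - unfold below, branch in *; lia.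
  - rewrite !(comb_branch _ _ _ Ht); apply sim_here; now left.
Qed.

(** A node with children is the root, similar only to itself, or a branch. *)
Lemma comb_sim m a b n :
  sim t (below eps m) a b -> fan t (S n) a ->
  a = b \/ exists y, b = branch eps y /\ m <= b.
Proof.
  intros Hs (l & _ & Hn & Hf); inversion Hs as [|? ? Ha Hb Hs']; subst; [now left|].
  destruct l as [|c l]; [discriminate Hn|].
  assert (Ea : exists x, a = branch eps x).
  { destruct (comb_range c) as [E|[x E]]; rewrite (Hf c) in E by now left.
    - exfalso; apply Ha; now left.
    - eauto. }
  destruct Ea as [x ->]; rewrite (comb_branch _ _ _ Ht) in Hs'.
  assert (Eb : t b = eps).
  { inversion Hs' as [? _ E|? ? Hr _ _]; subst; trivial.
    exfalso; apply Hr; now left. }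
  right; unfold below in Hb.
  destruct (comb_cases eps b) as [H|[->|[[y ->]|(y & s & ->)]]].
  - rewrite (comb_low _ _ _ Ht) in Eb by trivial; unfold branch in Eb; lia.
  - exfalso; apply Hb; now left.
  - exists y; split; trivial; lia.
  - exfalso; destruct (classic (Q y s)) as [HQ|HQ];
      [rewrite (comb_leaf _ _ _ Ht) in Eb|rewrite (comb_spare _ _ _ Ht) in Eb];
      trivial; unfold branch in Eb; lia.
Qed.

Lemma comb_balanced m :
  (forall x, x <> 0 -> m <= branch eps x -> forall B, exists s, B <= s /\ Q x s) ->
  balanced t (below eps m).
Proof.
  intros H a b [|n] Hs Ha; [exists []; repeat split; [constructor|now intros ? []]|].
  destruct (comb_sim m a b n Hs Ha) as [->|(y & -> & Hy)]; trivial.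
  destruct (Nat.eq_dec y 0) as [->|Hne]; [apply fan_branch_zero|].
  apply fan_branch; auto.
Qed.

(** Infinitely many branches with finite but unboundedly large fans: whatever
    finite set is fixed, two of them with different fans lie outside it. *)
Lemma comb_not_balanced m :
  (forall x, x <> 0 -> exists B, forall s, Q x s -> s < B) ->
  (forall x s, s < x -> Q x s) ->
  ~ balanced t (below eps m).
Proof.
  intros HB HQ H; destruct (HB (S m)) as [B HB']; [lia|].
  assert (S B <= B); [|lia].
  apply (fan_branch_le (S m)); [lia|trivial|].
  apply (H (branch eps (S B + m))).
  - apply sim_branch; [pose proof (branch_ge eps (S B + m))|
      pose proof (branch_ge eps (S m))]; lia.
  - apply fan_branch_ge; intros s Hs; apply HQ; lia.
Qed.

End Comb.

(** * Hardness *)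

Lemma UHP_hard eps A :
  Pi0 2 A ->
  exists f, computable f /\ (forall i, TRP eps (f i)) /\ forall i, A i <-> UHP eps (f i).
Proof.
  intros (R' & (R & HR & HR') & HA).
  assert (HA' : forall i, A i <-> forall x, exists y, R (cpair (cpair i x) y)).
  { intros i; rewrite HA; split; intros H x; now apply HR'. }
  (* Branch 0 always has infinitely many children, so branch [S x] stands for [x]. *)
  destruct (comb_reduction eps (fun i x s =>
              exists y, y < S s /\ R (cpair (cpair i (pred x)) y)))
    as (r & Hr & Hred).
  { apply (computable_set_bex (fun q => S (pi2 (pi2 q)))
      (fun q y => R (cpair (cpair (pi1 q) (pred (pi1 (pi2 q)))) y))); comp.
    apply (computable_set_comp R); comp. }
  exists r; split; trivial; split.
  { intros i; destruct (Hred i) as (t & Hc & Ht); exists t; repeat split; trivial;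
      now apply (comb_tree eps _ t Ht). }
  intros i; destruct (Hred i) as (t & Hc & Ht).
  pose proof (comb_tree _ _ _ Ht) as Htree; unfold UHP.
  rewrite (B_is_iff _ _ _ t), ultrahomogeneous_iff, HA' by trivial; split.
  - intros H; apply (comb_balanced _ _ _ Ht); intros x _ _ B.
    destruct (H (pred x)) as [y Hy]; exists (B + y); split; [lia|].
    exists y; split; [lia|trivial].
  (* A branch without children is similar to branch 0, which has children. *)
  - intros H x; apply NNPP; intros Hno.
    assert (1 <= 0); [|lia].
    apply (fan_branch_le _ _ _ Ht (S x)); [lia| |].
    + intros s (y & _ & Hy); exfalso; eauto.
    + apply (H (branch eps 0)); [|apply (fan_branch_zero _ _ _ Ht)].
      apply (sim_branch _ _ _ Ht); lia.
Qed.

Definition settled (r : nat -> nat -> Prop) (u y : nat) : Prop :=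
  forall x, x < S u -> exists y', y' < S y /\ r x y'.

(** [milestone r s] holds for at most one [s = cpair u y] for each [u]: [y] must be
    the least bound on witnesses for all [x <= u]. So there are infinitely many
    milestones exactly if every [x] has a witness. *)
Definition milestone (r : nat -> nat -> Prop) (s : nat) : Prop :=
  settled r (pi1 s) (pi2 s) /\ forall y, y < pi2 s -> ~ settled r (pi1 s) y.

Lemma milestone_unbounded r :
  (forall x, exists y, r x y) -> forall B, exists s, B <= s /\ milestone r s.
Proof.
  intros H B.
  assert (Hset : exists y, settled r B y).
  { unfold settled; induction (S B) as [|n (y & IH)]; [exists 0; lia|].
    destruct (H n) as [z Hz]; exists (y + z); intros x Hx.
    destruct (Nat.eq_dec x n) as [->|Hne]; [exists z; split; [lia|trivial]|].
    destruct (IH x ltac:(lia)) as (w & Hw & Hr); exists w; split; [lia|trivial]. }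
  destruct Hset as [y Hy]; induction y as [y IH] using lt_wf_ind.
  destruct (classic (exists z, z < y /\ settled r B z)) as [(z & Hz & Hs)|Hno];
    [eauto|].
  exists (cpair B y); split.
  - pose proof (Cantor.to_nat_non_decreasing B y); unfold cpair; lia.
  - unfold milestone; rewrite pi1_cpair, pi2_cpair; split; trivial.
    intros z Hz Hs; eauto.
Qed.

Lemma milestone_bounded r :
  ~ (forall x, exists y, r x y) -> exists B, forall s, milestone r s -> s < B.
Proof.
  intros H; apply not_all_ex_not in H as [x0 Hx].
  assert (Hn : forall n, exists B, forall s, milestone r s -> pi1 s < n -> s < B).
  { induction n as [|n [B IH]]; [exists 0; lia|].
    destruct (classic (exists s, milestone r s /\ pi1 s = n))
      as [(s & [Hs Hl] & En)|Hno].
    - exists (B + S s); intros s' Hs' Hlt.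
      destruct (Nat.eq_dec (pi1 s') n) as [En'|Hne];
        [|specialize (IH s' Hs' ltac:(lia)); lia].
      destruct Hs' as [Hs' Hl']; rewrite En in Hs, Hl; rewrite En' in Hs', Hl'.
      assert (pi2 s = pi2 s').
      { destruct (lt_eq_lt_dec (pi2 s) (pi2 s')) as [[Hc|Hc]|Hc]; trivial; exfalso;
          [apply (Hl' _ Hc)|apply (Hl _ Hc)]; trivial. }
      enough (s = s') by lia; rewrite <- (cpair_pi s), <- (cpair_pi s'); congruence.
    - exists B; intros s Hs Hlt; apply IH; trivial.
      enough (pi1 s <> n) by lia; eauto. }
  destruct (Hn x0) as [B HB]; exists B; intros s Hs; apply HB; trivial.
  destruct (le_lt_dec x0 (pi1 s)) as [Hle|]; trivial; exfalso; apply Hx.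
  destruct Hs as [Hs _]; destruct (Hs x0 ltac:(lia)) as (y & _ & Hy); eauto.
Qed.

Lemma WUP_hard eps A :
  Sigma0 3 A ->
  exists f, computable f /\ (forall i, TRP eps (f i)) /\ forall i, A i <-> WUP eps (f i).
Proof.
  intros (R'' & (R' & (R & HR & HR') & HR'') & HA).
  set (r := fun i w x y => R (cpair (cpair (cpair i w) x) y)).
  assert (HA' : forall i, A i <-> exists w, forall x, exists y, r i w x y).
  { intros i; rewrite HA; split; intros [w H]; exists w.
    - intros x; apply HR'; revert x; now apply HR''.
    - apply HR''; intros x; apply HR', H. }
  (* The first disjunct makes finite fans unboundedly large; the second makes one
     good [w] act on all branches from [w] on. *)
  destruct (comb_reduction eps (fun i x s =>
              s < x \/ exists w, w < S x /\ milestone (r i w) s))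
    as (f & Hf & Hred).
  { unfold milestone, settled, r.
    assert (Hset : forall a b c d, computable a -> computable b -> computable c ->
              computable d -> computable_set (fun p =>
                R (cpair (cpair (cpair (a p) (b p)) (c p)) (d p))))
      by (intros; apply (computable_set_comp R); comp).
    comp. }
  exists f; split; trivial; split.
  { intros i; destruct (Hred i) as (t & Hc & Ht); exists t; repeat split; trivial;
      now apply (comb_tree eps _ t Ht). }
  intros i; destruct (Hred i) as (t & Hc & Ht).
  pose proof (comb_tree _ _ _ Ht) as Htree; unfold WUP.
  rewrite (B_is_iff _ _ _ t), weakly_ultrahomogeneous_iff, HA' by trivial; split.
  - intros [w Hw].
    assert (Hm : exists m, forall x, x < w -> branch eps x < m).
    { clear; induction w as [|w [m IH]]; [exists 0; lia|].
      exists (m + S (branch eps w)); intros x Hx.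
      destruct (Nat.eq_dec x w) as [->|Hne]; [lia|].
      specialize (IH x ltac:(lia)); lia. }
    destruct Hm as [m Hm]; exists m; apply (comb_balanced _ _ _ Ht).
    intros x _ Hle B; destruct (milestone_unbounded _ Hw B) as (s & Hs & Hmil).
    exists s; split; trivial; right; exists w; split; trivial.
    destruct (le_lt_dec w x) as [|Hlt]; [lia|apply Hm in Hlt; lia].
  - intros [m Hm]; apply NNPP; intros Hno; revert Hm.
    apply (comb_not_balanced _ _ _ Ht); [|auto].
    intros x _.
    assert (HB : exists B, forall w, w < S x -> forall s, milestone (r i w) s -> s < B).
    { induction (S x) as [|n [B IH]]; [exists 0; lia|].
      destruct (milestone_bounded (r i n)) as [B' HB']; [eauto|].
      exists (B + B'); intros w Hw s Hs.
      destruct (Nat.eq_dec w n) as [->|Hne]; [apply HB' in Hs; lia|].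
      specialize (IH w ltac:(lia) s Hs); lia. }
    destruct HB as [B HB]; exists (x + B); intros s [Hs|(w & Hw & Hs)]; [lia|].
    specialize (HB w Hw s Hs); lia.
Qed.

Theorem theorem7p17 :
  forall eps : nat,
    complete_relative (Pi0 2) (UHP eps) (TRP eps) /\
    complete_relative (Sigma0 3) (WUP eps) (TRP eps).
Proof.
  intros eps; split; (split; [|split]).
  - intros e (f & He & Ht & _); now exists f.
  - apply UHP_upper.
  - apply UHP_hard.
  - intros e (f & He & Ht & _); now exists f.
  - apply WUP_upper.
  - apply WUP_hard.
Qed.
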